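(* The expansion of $\mathfrak b_n$ is \[O\left(\frac{1}{\sqrt{n}}\right).\] The mixing time of the simple random walk on $\mathfrak b_n$ is \[\Omega\left(n^{3/2}\right).\]
   Context: The graph $\mathfrak b_n$ (the $1$-skeleton of the $n$-dimensional type-$B$ associahedron, or cyclohedron): Let $P_{2n+2}$ be a regular $(2n+2)$-gon. The vertices of $\mathfrak b_n$ are the centrally symmetric triangulations of $P_{2n+2}$ (maximal sets of pairwise non-crossing diagonals of $P_{2n+2}$ that are invariant under rotation by $180^\circ$ about the center). Two such triangulations are adjacent if one can be obtained from the other via one of the following flips: (1) a diagonal flip that replaces one diagonal of the $(2n+2)$-gon with another diagonal; (2) a pair of centrally symmetric diagonal flips, which replaces two centrally symmetric diagonals with two other centrally symmetric diagonals. In a flip, a diagonal is replaced by the other diagonal of the unique quadrilateral of the triangulation that contains it. The graph $\mathfrak b_n$ is regular of degree $n$ and has $\binom{2n}{n}$ vertices. Expansion: for a finite simple graph $G=(V,E)$ and $S\subseteq V$, let $\partial S=\{\{s,t\}\in E: s\in S,\ t\notin S\}$. The expansion of $G$ is \[h(G)=\min_{\emptyset\neq S\subseteq V,\ |S|\le |V|/2}\frac{|\partial S|}{|S|}.\] Simple random walk: the Markov chain with state space $V$ that, from state $v$, moves to a neighbor of $v$ chosen uniformly at random, with laziness imposed so that the walk stays at $v$ with probability $1/2$ at each step. On a connected regular graph its unique stationary distribution $\pi^*$ is the uniform distribution on $V$. Mixing time: for probability distributions $\mu,\nu$ on a finite set $\Omega$, the total variation distance is $d(\mu,\nu)=\frac12\sum_{x\in\Omega}|\mu(x)-\nu(x)|$.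 For an irreducible Markov chain on $\Omega$ with stationary distribution $\pi^*$, let $\mu_t^\xi$ be the distribution at time $t$ of the chain started at $\xi\in\Omega$. For each $\varepsilon>0$, the mixing time $\tau(\varepsilon)$ is the smallest nonnegative integer such that $\max_{\xi\in\Omega} d(\mu_t^\xi,\pi^* )<\varepsilon$ for all $t\ge\tau(\varepsilon)$. The asymptotic bounds are as $n\to\infty$. *)

(* Defs.v *)
From HB Require Import structures.
From mathcomp Require Import all_boot all_order all_algebra.
From mathcomp Require Import all_classical all_reals all_analysis.

Set Implicit Arguments.
Unset Strict Implicit.
Unset Printing Implicit Defensive.

Import Order.TTheory GRing.Theory Num.Theory.
Import numFieldNormedType.Exports.

Local Open Scope ring_scope.

(* The vertices of a convex N-gon are the elements of 'I_N in cyclic order;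
   a segment between two of them is the 2-element set of its endpoints. *)
Section Polygon.
Variable N : nat.
Implicit Types (d : {set 'I_N}) (T : {set {set 'I_N}}).

Definition is_side d : bool := [exists i, d == [set i; ordS i]].

Definition is_diagonal d : bool := (#|d| == 2)%N && ~~ is_side d.

Definition interleave d d' : bool :=
  [exists i : 'I_N, exists j : 'I_N, exists k : 'I_N, exists l : 'I_N,
    [&& (i < j)%N, (j < k)%N, (k < l)%N, d == [set i; k] & d' == [set j; l]]].

(* Segments sharing an endpoint do not cross. *)
Definition crossing d d' : bool := interleave d d' || interleave d' d.

Definition noncrossing T : bool :=
  [forall d in T, is_diagonal d] &&
  [forall d in T, forall d' in T, ~~ crossing d d'].

Definition triangulation T : bool := maxset noncrossing T.

(* i, j, k, l are the vertices, in cyclic order, of a quadrilateral of T one of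
   whose diagonals is d, and d' is its other diagonal. *)
Definition quad_flip T d d' : bool :=
  (d \in T) &&
  [exists i : 'I_N, exists j : 'I_N, exists k : 'I_N, exists l : 'I_N,
    let edge a b := ([set a; b] \in T) || is_side [set a; b] in
    [&& (i < j)%N, (j < k)%N, (k < l)%N,
        [&& edge i j, edge j k, edge k l & edge i l] &
        ((d == [set i; k]) && (d' == [set j; l]))
        || ((d == [set j; l]) && (d' == [set i; k]))]].

End Polygon.

Section TypeB.
Variable n : nat.

Local Notation vtx := 'I_(2 * n + 2).

Definition half_turn (i : vtx) : vtx := iter n.+1 (@ordS (2 * n + 2)) i.

Definition half_turn_seg (d : {set vtx}) : {set vtx} :=
  [set half_turn i | i in d].

Definition centrally_symmetric (T : {set {set vtx}}) : bool :=
  [set half_turn_seg d | d in T] == T.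

Definition b_vertex : finType :=
  {T : {set {set vtx}} | triangulation T && centrally_symmetric T}.

Definition single_flip (T T' : {set {set vtx}}) : bool :=
  [exists d, exists d', quad_flip T d d' && (T' == d' |: (T :\ d))].

Definition double_flip (T T' : {set {set vtx}}) : bool :=
  [exists d, exists d',
    [&& half_turn_seg d != d,
        quad_flip T d d',
        quad_flip T (half_turn_seg d) (half_turn_seg d') &
        T' == [set d'; half_turn_seg d']
                :|: (T :\: [set d; half_turn_seg d])]].

Definition b_adj : rel b_vertex :=
  fun T T' => single_flip (val T) (val T') || double_flip (val T) (val T').

End TypeB.

Section Graph.
Variables (R : realType) (V : finType) (adj : rel V).

Definition edge_boundary (S : {set V}) : {set {set V}} :=
  [set [set s; t] | s in S, t in ~: S & adj s t].

(* The infimum is over a finite set, which is nonempty as soon as V has at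
   least two elements, so it is then a minimum. *)
Definition expansion : R :=
  inf [set r | exists S : {set V},
        [/\ S != finset.set0, (2 * #|S| <= #|V|)%N &
            r = #|edge_boundary S|%:R / #|S|%:R]]%classic.

Definition degree (v : V) : nat := #|[set w | adj v w]|.

Definition lazy_walk (v w : V) : R :=
  2^-1 * (v == w)%:R + 2^-1 * ((adj v w)%:R / (degree v)%:R).

End Graph.

Section Mixing.
Variables (R : realType) (X : finType).
Implicit Types (P : X -> X -> R) (mu nu pi : X -> R).

Definition tv_dist mu nu : R := 2^-1 * \sum_(x : X) `|mu x - nu x|.

Definition step P mu : X -> R := fun y => \sum_(x : X) mu x * P x y.

Definition law_at P (xi : X) (t : nat) : X -> R :=
  iter t (step P) (fun x => (x == xi)%:R).

Definition is_stationary P pi : Prop :=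
  [/\ forall x, 0 <= pi x, \sum_(x : X) pi x = 1 & step P pi = pi].

Definition mixed_from P pi (eps : R) (t : nat) : Prop :=
  forall s, (t <= s)%N ->
    \big[Num.max/0]_(xi : X) tv_dist (law_at P xi s) pi < eps.

Definition is_mixing_time P pi (eps : R) (tau : nat) : Prop :=
  mixed_from P pi eps tau /\
  forall t, mixed_from P pi eps t -> (tau <= t)%N.

End Mixing.

(* Main.v *)
Require Import Defs.
From HB Require Import structures.
From mathcomp Require Import all_classical all_reals all_analysis.
From mathcomp Require Import all_boot all_order all_algebra.
From mathcomp Require Import zify ring lra.

(** For n > 0, every centrally symmetric triangulation of the (2n+2)-gon contains
    exactly one diameter ([exists_diam], [diam_unique]), and it is determined by that
    diameter together with a triangulation of the (n+2)-gon on one side of it,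
    that is, by a binary tree with n+1 leaves ([symmetrizedP],
    [symmetrized_inj]).  The n+1 diameters are cyclically ordered, and each of
    them carries the same number G of triangulations, the n-th Catalan number.

    Let S be the set of vertices whose diameter lies in an arc of m consecutive
    diameters.  Only a flip of the diameter itself can leave S, so each vertex
    of S has at most one neighbour outside.  If the triangle resting on the
    diameter cuts the half polygon into pieces with k and n+1-k sides, then that
    flip moves the diameter by k steps, and at most min(k, n+1-k) diameters of
    the arc leave it when they are moved by k steps.  With c(k) the number of
    trees with k leaves, the boundary of S therefore has at most
      E = sum over 0 < k <= n of min(k, n+1-k) c(k) c(n+1-k)
    edges, whatever m is ([card_out_pairs]).  Since min(x, y) <= 2xy/(x+y), and
    since k c(k) is a central binomial coefficient b(k-1), the identity
    sum b(i) b(j) = 4^(n-1) over i+j = n-1 gives (n+1) E <= 4^n / 2; comparing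
    with (n+1) G = b(n) >= 4^n / (2 sqrt n) yields E <= sqrt n G
    ([escape_count_le]).  As S has m G vertices, the boundary of S has at most
    sqrt n / m edges per vertex of S.

    For the expansion, take m to be (n+1)/2 rounded down.

    For the mixing time, start the walk in S with probabilities proportional to
    the degrees.  The law at any later time is dominated by the degrees, up to
    the same normalisation, so at each step a mass of at most E / (2 vol S)
    leaves S ([mixing_escape]), where vol S is the sum of the degrees.  Each
    degree is at least n-1, because the n-1 rotations of a binary tree with n+1
    leaves give distinct neighbours ([degree_ge]); hence this mass is
    O(1 / (sqrt n m)).  Fix K with 2/K <= 1-eps and let m be about n/K.  Among K
    disjoint arcs of length m, one gives a set of stationary measure at most
    1/K ([vertex_measure_arc]); small sets are needed because eps may be close
    to 1.  If the walk is eps-close to stationarity at time t, a mass of at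
    least 1 - eps - 1/K >= (1-eps)/2 has left this set, so t is at least of
    order n^(3/2) ([mixing_time_ge]). *)

Set Implicit Arguments.
Unset Strict Implicit.
Unset Printing Implicit Defensive.

Import Order.TTheory GRing.Theory Num.Theory.
Import numFieldNormedType.Exports.

Local Open Scope nat_scope.

(** * Binary trees and the intervals of their subtrees *)

Inductive btree := Leaf | Node (l r : btree).

Definition btree_eq_dec (t t' : btree) : {t = t'} + {t <> t'}.
Proof. decide equality. Defined.

HB.instance Definition _ := hasDecEq.Build btree (compareP btree_eq_dec).

Fixpoint leaves (t : btree) : nat :=
  if t is Node l r then leaves l + leaves r else 1.

(** A tree with w leaves triangulates the polygon with corners c, ..., c+w
    whose sides are the unit intervals (the leaves) and the base [c, c+w]
    (the root): an inner node stands for the segment spanned by its leaves.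
    Leaves stand for sides, which are not diagonals, so only the inner nodes
    are listed. *)
Fixpoint intervals (t : btree) (c : nat) : seq (nat * nat) :=
  if t is Node l r then
    (c, c + leaves t) :: intervals l c ++ intervals r (c + leaves l)
  else [::].

Lemma leaves_gt0 t : 0 < leaves t.
Proof. by elim: t => //= l IHl r _; rewrite addn_gt0 IHl. Qed.

Lemma intervals_bounds t c p q :
  (p, q) \in intervals t c -> [/\ c <= p, p + 2 <= q & q <= c + leaves t].
Proof.
elim: t c => [|l IHl r IHr] c //=.
have := leaves_gt0 l; have := leaves_gt0 r => r0 l0.
rewrite inE mem_cat xpair_eqE => /orP[/andP[/eqP-> /eqP->]|]; first by split; lia.
by case/orP=> [/IHl|/IHr] [*]; split; lia.
Qed.

Lemma intervals_shift t c k p q :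
  ((p + k, q + k) \in intervals t (c + k)) = ((p, q) \in intervals t c).
Proof.
elim: t c => //= l IHl r IHr c; rewrite !inE !mem_cat -IHl -(IHr (c + leaves l)).
rewrite !xpair_eqE eqn_add2r addnAC eqn_add2r; congr [|| _, _ | _].
by congr (_ \in intervals r _); lia.
Qed.

Lemma intervals_root t c :
  1 < leaves t -> (c, c + leaves t) \in intervals t c.
Proof. by case: t => //= l r _; rewrite inE eqxx. Qed.

Lemma intervals_laminar t c p q r s :
  (p, q) \in intervals t c -> (r, s) \in intervals t c ->
  ~~ [&& p < r, r < q & q < s].
Proof.
elim: t c => [|t1 IH1 t2 IH2] c //= pq rs; apply/negP => /and3P[pr rq qs].
move: pq rs; rewrite !inE !mem_cat !xpair_eqE.
case/or3P=> [/andP[/eqP ep /eqP eq]|pq|pq];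
case/or3P=> [/andP[/eqP er /eqP es]|rs|rs];
  try (move/intervals_bounds: (pq) => [? ? ?]);
  try (move/intervals_bounds: (rs) => [? ? ?]); try lia.
  by move: (IH1 _ pq rs); rewrite pr rq qs.
by move: (IH2 _ pq rs); rewrite pr rq qs.
Qed.

(** A segment that jumps over the apex of the triangle on the base crosses
    one of its two other sides, unless it is the base; any other segment
    lives in one of the two subtrees. *)
Lemma intervals_maximal t c p q :
  c <= p -> p + 2 <= q -> q <= c + leaves t ->
  (forall r s, (r, s) \in intervals t c ->
     ~~ [&& p < r, r < q & q < s] && ~~ [&& r < p, p < s & s < q]) ->
  (p, q) \in intervals t c.
Proof.
elim: t c => [|t1 IH1 t2 IH2] c cp pq qc nc; first by move: qc => /=; lia.
rewrite /= !inE mem_cat xpair_eqE.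
have sub1 r s : (r, s) \in intervals t1 c -> (r, s) \in intervals (Node t1 t2) c.
  by move=> h; rewrite /= inE mem_cat h orbT.
have sub2 r s : (r, s) \in intervals t2 (c + leaves t1) ->
    (r, s) \in intervals (Node t1 t2) c.
  by move=> h; rewrite /= inE mem_cat h !orbT.
have [q1|q1] := leqP q (c + leaves t1).
  by rewrite (IH1 c) ?orbT // => r s /sub1 /nc.
have [p1|p1] := leqP (c + leaves t1) p.
  rewrite (IH2 (c + leaves t1)) ?orbT //; first by move: qc => /=; lia.
  by move=> r s /sub2 /nc.
suff [-> ->] : p = c /\ q = c + (leaves t1 + leaves t2) by rewrite !eqxx.
move: (qc) => /= qc'; split.
  apply/eqP; rewrite eqn_leq cp andbT leqNgt; apply/negP => cp'.
  by have := nc _ _ (sub1 _ _ (@intervals_root t1 c ltac:(lia))); lia.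
apply/eqP; rewrite eqn_leq qc' /= leqNgt; apply/negP => cp'.
by have := nc _ _ (sub2 _ _ (@intervals_root t2 (c + leaves t1) ltac:(lia))); lia.
Qed.

(** The apex of the triangle on the base can be read off from the intervals:
    two different apices would give two crossing intervals. *)
Lemma intervals_inj t t' c :
  leaves t = leaves t' -> {subset intervals t c <= intervals t' c} -> t = t'.
Proof.
elim: t t' c => [|l IHl r IHr] [|l' r'] c //=.
- by have := leaves_gt0 l'; have := leaves_gt0 r'; lia.
- by have := leaves_gt0 l; have := leaves_gt0 r; lia.
move=> ew sub.
have l0 := leaves_gt0 l; have r0 := leaves_gt0 r.
have l0' := leaves_gt0 l'; have r0' := leaves_gt0 r'.
have subl p q : (p, q) \in intervals l c -> (p, q) \in intervals (Node l' r') c.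
  by move=> h; apply: sub; rewrite inE mem_cat h orbT.
have subr p q : (p, q) \in intervals r (c + leaves l) ->
    (p, q) \in intervals (Node l' r') c.
  by move=> h; apply: sub; rewrite inE mem_cat h !orbT.
have el : leaves l = leaves l'.
  have rootl' : 1 < leaves l' ->
      (c, c + leaves l') \in intervals (Node l' r') c.
    by move=> h; rewrite /= inE mem_cat intervals_root ?orbT.
  have rootr' : 1 < leaves r' ->
      (c + leaves l', c + leaves l' + leaves r') \in intervals (Node l' r') c.
    by move=> h; rewrite /= inE mem_cat intervals_root ?orbT.
  case: (ltngtP (leaves l) (leaves l')) => // h.
    have a := rootl' ltac:(lia).
    have b := subr _ _ (@intervals_root r (c + leaves l) ltac:(lia)).
    by have := intervals_laminar a b; lia.
  have a := rootr' ltac:(lia).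
  have b := subl _ _ (@intervals_root l c ltac:(lia)).
  by have := intervals_laminar b a; lia.
have er : leaves r = leaves r' by lia.
congr Node; [apply: (IHl _ c)|apply: (IHr _ (c + leaves l))] => // -[p q] h.
  have [? ? ?] := intervals_bounds h.
  move: (subl _ _ h); rewrite /= inE mem_cat xpair_eqE => /or3P[|//|]; first lia.
  by case/intervals_bounds; lia.
have [? ? ?] := intervals_bounds h.
move: (subr _ _ h); rewrite /= inE mem_cat xpair_eqE => /or3P[||].
- by lia.
- by case/intervals_bounds; lia.
- by rewrite el.
Qed.

Lemma leaves1 t : leaves t = 1 -> t = Leaf.
Proof. by case: t => //= l r; have := leaves_gt0 l; have := leaves_gt0 r; lia. Qed.

(** The first argument is fuel for the recursion; any value of at least [m]
    gives the full list of trees with [m] leaves. *)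
Fixpoint btrees_upto (f m : nat) : seq btree :=
  if f is f'.+1 then
    if m == 1 then [:: Leaf] else
    flatten [seq [seq Node l r | l <- btrees_upto f' k, r <- btrees_upto f' (m - k)]
            | k <- iota 1 m.-1]
  else [::].

Lemma mem_btrees_upto f m t :
  m <= f -> (t \in btrees_upto f m) = (leaves t == m).
Proof.
elim: f m t => [|f IH] m t mf /=.
  by rewrite in_nil; have := leaves_gt0 t; lia.
case: (altP (m =P 1)) => [->|m1].
  by rewrite inE; apply/eqP/eqP => [->//|/leaves1].
apply/flatten_mapP/eqP => [[k]|].
  rewrite mem_iota => hk /allpairsP[[l r] /= [hl hr ->]] /=.
  by move: hl hr; rewrite !IH; lia.
case: t => [/=|l r /= e]; first by move=> e; rewrite -e in m1.
have := leaves_gt0 l; have := leaves_gt0 r => r0 l0.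
exists (leaves l); first by rewrite mem_iota; lia.
apply/allpairsP; exists (l, r); split => //=; rewrite IH; lia.
Qed.

Lemma uniq_btrees_upto f m : m <= f -> uniq (btrees_upto f m).
Proof.
elim: f m => [|f IH] m mf //=.
case: (altP (m =P 1)) => [//|m1].
have : forall k, k \in iota 1 m.-1 -> 0 < k < m by move=> k; rewrite mem_iota; lia.
elim: (iota _ _) (iota_uniq 1 m.-1) => //= k ks IHk /andP[knotin uks] hks.
rewrite cat_uniq IHk //; last by move=> j jks; apply: hks; rewrite inE jks orbT.
rewrite andbT; have hk := hks k (mem_head _ _).
apply/andP; split.
  apply: allpairs_uniq; [by apply: IH; lia|by apply: IH; lia|].
  by move=> [l r] [l' r'] _ _ [-> ->].
apply/hasPn => t /flatten_mapP[j jks /allpairsP[[l r] /= [hl hr ->]]].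
apply/negP => /allpairsP[[l' r'] /= [hl' hr' [el er]]].
have hj := hks j; rewrite inE jks orbT in hj; have {}hj := hj isT.
move: hl hl'; rewrite !mem_btrees_upto; [|lia..].
by rewrite el => /eqP ej /eqP ek; rewrite -ek ej jks in knotin.
Qed.

Definition btrees m := btrees_upto m m.

Lemma mem_btrees m t : (t \in btrees m) = (leaves t == m).
Proof. exact: mem_btrees_upto. Qed.

Lemma uniq_btrees m : uniq (btrees m).
Proof. exact: uniq_btrees_upto. Qed.

Definition left_leaves t := if t is Node l _ then leaves l else 0.

Lemma count_left_leaves m k : 0 < k < m ->
  count (fun t => left_leaves t == k) (btrees m) =
  size (btrees k) * size (btrees (m - k)).
Proof.
move=> hk; rewrite -size_filter -(size_allpairs Node).
apply/perm_size/uniq_perm; first by rewrite filter_uniq ?uniq_btrees.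
  apply: allpairs_uniq; rewrite ?uniq_btrees //.
  by move=> [l r] [l' r'] _ _ [-> ->].
move=> t; rewrite mem_filter mem_btrees.
apply/andP/allpairsP => [|[[l r] /= [hl hr ->]]].
  case: t => [/=|l r /= [/eqP hl /eqP hr]]; first by move=> [/eqP]; lia.
  by exists (l, r); split=> //=; rewrite mem_btrees; lia.
by rewrite !mem_btrees in hl hr; move=> /=; lia.
Qed.

(** Segner's decomposition at the root, refined by a condition on the size
    of the left subtree; that size is the displacement of the diameter when
    it is flipped. *)
Lemma count_by_left_leaves (P : pred nat) m : 1 < m ->
  count (fun t => P (left_leaves t)) (btrees m) =
  \sum_(1 <= k < m) P k * (size (btrees k) * size (btrees (m - k))).
Proof.
move=> m1; under eq_big_nat => k hk do rewrite -(count_left_leaves hk).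
have : forall t, t \in btrees m -> 0 < left_leaves t < m.
  move=> t; rewrite mem_btrees; case: t => [|l r] /=; first lia.
  by have := leaves_gt0 l; have := leaves_gt0 r; lia.
elim: (btrees m) => [_|t s IH hs] /=; first by rewrite big1 // => k _; rewrite muln0.
under eq_bigr do rewrite mulnDr.
rewrite big_split /= -IH; last by move=> u us; apply: hs; rewrite inE us orbT.
congr addn; have ht := hs t (mem_head _ _).
rewrite (bigD1_seq (left_leaves t)) ?iota_uniq //=; last by rewrite mem_index_iota.
rewrite eqxx muln1 big1 ?addn0 // => i.
by rewrite eq_sym => /negbTE->; rewrite muln0.
Qed.

Lemma size_btrees m : 1 < m ->
  size (btrees m) = \sum_(1 <= k < m) size (btrees k) * size (btrees (m - k)).
Proof.
move=> m1; rewrite -count_predT (count_by_left_leaves predT) //.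
by apply: eq_bigr => k _; rewrite mul1n.
Qed.

Lemma root_apex_unique t c x : c < x -> x < c + leaves t ->
  (x == c.+1) || ((c, x) \in intervals t c) ->
  (c + leaves t == x.+1) || ((x, c + leaves t) \in intervals t c) ->
  x = c + left_leaves t.
Proof.
case: t => [|l r]; first by move=> /=; lia.
move=> cx xt e1 e2; rewrite -[left_leaves _]/(leaves l).
have l0 := leaves_gt0 l; have r0 := leaves_gt0 r.
have et : leaves (Node l r) = leaves l + leaves r by [].
case: (ltngtP x (c + leaves l)) => // h.
  have h1 : (c, c + leaves l) \in intervals (Node l r) c.
    by rewrite /= inE mem_cat intervals_root ?orbT //; lia.
  by case/orP: e2 => [|h2]; [lia|have := intervals_laminar h1 h2; lia].
have h1 : (c + leaves l, c + leaves (Node l r)) \in intervals (Node l r) c.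
  by rewrite et /= inE mem_cat addnA intervals_root ?orbT //; lia.
by case/orP: e1 => [|h2]; [lia|have := intervals_laminar h2 h1; lia].
Qed.

(** * Catalan numbers *)

Definition convolution (a : nat -> nat) (n : nat) : nat :=
  \sum_(i < n.+1) a i * a (n - i).

(** The exchange of i and n-i pairs the weights i and n-i, so that each
    product has average weight n/2. *)
Lemma convolution_weighted (a : nat -> nat) n :
  2 * (\sum_(i < n.+1) i * (a i * a (n - i))) = n * convolution a n.
Proof.
rewrite mul2n -addnn {2}(reindex_inj rev_ord_inj) /= -big_split big_distrr /=.
apply: eq_bigr => i _; have i_n := ltn_ord i.
by rewrite subSS subKn; [|lia]; rewrite [a (n - i) * _]mulnC -mulnDl subnKC //; lia.
Qed.

Definition catalan k := size (btrees k.+1).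

Lemma catalan_convolution n : catalan n.+1 = convolution catalan n.
Proof.
rewrite /catalan size_btrees // big_add1 big_mkord.
by apply: eq_bigr => i _; rewrite subSS subSn //; have := ltn_ord i.
Qed.

(** The two-term recurrence comes out of Segner's convolution alone: the sum
    of (i+1) C_i C_(n+1-i) is (n+3)/2 C_(n+2) by symmetry, and it is also
    C_(n+1) plus the sum of (i+2) C_(i+1) C_(n-i), where the induction
    hypothesis replaces (i+2) C_(i+1) by (4i+2) C_i. *)
Lemma catalanS k : k.+2 * catalan k.+1 = (4 * k + 2) * catalan k.
Proof.
elim/ltn_ind: k => -[|n] IH.
  by rewrite catalan_convolution /convolution big_ord1.
have e1 := convolution_weighted catalan n.+1; rewrite -catalan_convolution in e1.
have e0 := convolution_weighted catalan n; rewrite -catalan_convolution in e0.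
have e2 : \sum_(i < n.+2) i.+1 * (catalan i * catalan (n.+1 - i)) =
    \sum_(i < n.+2) i * (catalan i * catalan (n.+1 - i)) + catalan n.+2.
  by rewrite catalan_convolution -big_split; apply: eq_bigr => i _; rewrite mulSn addnC.
rewrite big_ord_recl /= /bump /= in e2.
have e3 : \sum_(i < n.+1) (1 + i).+1 * (catalan (1 + i) * catalan (n.+1 - (1 + i))) =
   4 * (\sum_(i < n.+1) i * (catalan i * catalan (n - i))) + 2 * catalan n.+1.
  rewrite catalan_convolution !big_distrr -big_split /=; apply: eq_bigr => i _.
  by rewrite mulnA add1n IH ?ltn_ord // subSS; ring.
rewrite e3 in e2; rewrite (_ : catalan 0 = 1) // subn0 in e2.
move: e0 e1 e2 {IH e3}; set S0 := \sum_(i < _) _; set S1 := \sum_(i < _) _; nia.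
Qed.

(** This is the binomial coefficient of 2k over k. The form chosen here is
    the one in which it meets the number of trees. *)
Definition central_binomial k := k.+1 * catalan k.

Lemma central_binomialS k :
  k.+1 * central_binomial k.+1 = (4 * k + 2) * central_binomial k.
Proof. by rewrite /central_binomial catalanS; lia. Qed.

(** The same double evaluation as in [catalanS], now with weights i, shows
    that the convolution is multiplied by 4 at each step. *)
Lemma central_binomial_convolution n : convolution central_binomial n = 4 ^ n.
Proof.
elim: n => [|n IH]; first by rewrite /convolution big_ord1.
have e1 := convolution_weighted central_binomial n.+1.
have e0 := convolution_weighted central_binomial n.
rewrite big_ord_recl mul0n add0n /= /bump /= in e1.
have e3 : \sum_(i < n.+1) (1 + i) *
       (central_binomial (1 + i) * central_binomial (n.+1 - (1 + i))) =
   4 * (\sum_(i < n.+1) i * (central_binomial i * central_binomial (n - i)))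
   + 2 * convolution central_binomial n.
  rewrite !big_distrr -big_split /=; apply: eq_bigr => i _.
  by rewrite mulnA add1n central_binomialS subSS; ring.
rewrite e3 in e1; rewrite expnS -IH; apply/eqP.
by rewrite -(@eqn_pmul2l n.+1) //; lia.
Qed.

(** The ratio of the right-hand side at n+1 and at n is 16 (2n+1)^2 /
    (4n(n+1)), which exceeds 16; at n = 1 there is equality. *)
Lemma central_binomial_ge n : 0 < n -> 16 ^ n <= 4 * n * central_binomial n ^ 2.
Proof.
elim: n => // -[_ _|n IH _]; first by have := central_binomialS 0; rewrite !mul1n => ->.
have {}IH := IH isT; have e := central_binomialS n.+1.
set b := central_binomial n.+1 in IH e; set b' := central_binomial n.+2 in e *.
rewrite -(@leq_pmul2l (n.+2 * n.+1)) // expnS.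
have -> : n.+2 * n.+1 * (4 * n.+2 * b' ^ 2) = 4 * n.+1 * (n.+2 * b') ^ 2 by ring.
rewrite e; apply: leq_trans (_ : n.+2 * n.+1 * (16 * (4 * n.+1 * b ^ 2)) <= _).
  by rewrite !leq_pmul2l.
have -> : n.+2 * n.+1 * (16 * (4 * n.+1 * b ^ 2)) =
  (4 * n.+1 * b ^ 2) * (16 * (n.+1 * n.+2)) by ring.
have -> : 4 * n.+1 * ((4 * n.+1 + 2) * b) ^ 2 =
  (4 * n.+1 * b ^ 2) * (4 * n.+1 + 2) ^ 2 by ring.
by rewrite leq_mul2l; apply/orP; right; lia.
Qed.

(** With [m] = n+1 this bounds the number of edges that leave any arc of
    diameters: a tree whose root splits as k + (m-k) lets at most min(k,
    m-k) diameters of the arc escape. *)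
Definition escape_count m :=
  \sum_(1 <= k < m) minn k (m - k) * (size (btrees k) * size (btrees (m - k))).

(** The bound min(x, y) (x+y) <= 2xy turns m times the sum into twice a
    convolution of central binomial coefficients, which is a power of 4.
    Everything is squared in order to avoid the square root. *)
Lemma escape_count_le n : 0 < n ->
  escape_count n.+1 ^ 2 <= n * size (btrees n.+1) ^ 2.
Proof.
case: n => // n _.
have h1 : 2 * (n.+2 * escape_count n.+2) <= 4 ^ n.+1.
  rewrite expnS -central_binomial_convolution /escape_count /convolution.
  rewrite big_add1 big_mkord /=.
  rewrite !big_distrr /=; apply: leq_sum => i _; have := ltn_ord i => hi.
  have -> : n.+2 - i.+1 = (n - i).+1 by lia.
  rewrite /central_binomial /catalan.
  set x := size (btrees i.+1); set y := size _.
  have -> : 4 * (i.+1 * x * ((n - i).+1 * y)) = 4 * (i.+1 * (n - i).+1) * (x * y).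
    by ring.
  rewrite !mulnA -[2 * _ * _ * x * y]mulnA -[4 * _ * _ * x * y]mulnA leq_mul2r.
  apply/orP; right.
  have -> : n.+2 = i.+1 + (n - i).+1 by lia.
  by rewrite /minn; case: ifP => h; nia.
have h2 := central_binomial_ge (ltn0Sn n).
rewrite /central_binomial /catalan in h2.
have h3 : (2 * (n.+2 * escape_count n.+2)) ^ 2 <= (4 ^ n.+1) ^ 2 by rewrite leq_exp2r.
rewrite -(expnM 4) (mulnC n.+1) (expnM 4) in h3.
have h4 := leq_trans h3 h2.
rewrite -(@leq_pmul2l (4 * n.+2 ^ 2)) //.
move: h4; congr (_ <= _); ring.
Qed.

(** * Rotations of binary trees *)

Definition left_subtree t := if t is Node l _ then l else Leaf.

(** The rotations at all inner edges of a tree; on triangulations they are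
    the flips of the segments other than the base. *)
Fixpoint rotations (t : btree) : seq btree :=
  if t is Node l r then
    [seq Node l' r | l' <- rotations l] ++ [seq Node l r' | r' <- rotations r]
    ++ (if l is Node l1 l2 then [:: Node l1 (Node l2 r)] else [::])
    ++ (if r is Node r1 r2 then [:: Node (Node l r1) r2] else [::])
  else [::].

Lemma size_rotations t : size (rotations t) = leaves t - 2.
Proof.
elim: t => // l IHl r IHr /=; rewrite !size_cat !size_map IHl IHr.
have := leaves_gt0 l; have := leaves_gt0 r.
have leaves2 u1 u2 : 1 < leaves u1 + leaves u2.
  by have := leaves_gt0 u1; have := leaves_gt0 u2; lia.
move=> _ _; case: l {IHl} => [|l1 l2]; case: r {IHr} => [|r1 r2] //=.
- by have := leaves2 r1 r2; lia.
- by have := leaves2 l1 l2; lia.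
- by have := leaves2 r1 r2; have := leaves2 l1 l2; lia.
Qed.

Lemma leaves_rotations t t' : t' \in rotations t -> leaves t' = leaves t.
Proof.
elim: t t' => // l IHl r IHr t' /=; rewrite !mem_cat.
case/or4P=> [/mapP[u /IHl e ->]|/mapP[u /IHr e ->]|h|h] /=; try by rewrite e.
  by case: l h {IHl} => // l1 l2; rewrite inE => /eqP -> /=; lia.
by case: r h {IHr} => // l1 l2; rewrite inE => /eqP -> /=; lia.
Qed.

Lemma rotations_irr t : t \notin rotations t.
Proof.
elim: t => // l IHl r IHr /=; rewrite !mem_cat; apply/negP.
case/or4P=> [/mapP[u uin [e]]|/mapP[u uin [e]]|h|h].
- by rewrite -e in uin; rewrite uin in IHl.
- by rewrite -e in uin; rewrite uin in IHr.
- move: h; case: l {IHl} => // l1 l2; rewrite inE => /eqP[e1 e2].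
  by have := congr1 leaves e1; have := leaves_gt0 l2 => /=; lia.
- move: h; case: r {IHr} => // l1 l2; rewrite inE => /eqP[e1 e2].
  by have := congr1 leaves e2; have := leaves_gt0 l1 => /=; lia.
Qed.

(** The left subtree of the result tells the four kinds of rotation apart:
    it has changed without changing size, is unchanged, has shrunk, or has
    grown. *)
Lemma uniq_rotations t : uniq (rotations t).
Proof.
elim: t => // l IHl r IHr /=.
have in_l u : u \in [seq Node l' r | l' <- rotations l] ->
    leaves (left_subtree u) = leaves l /\ left_subtree u != l.
  case/mapP => v vin -> /=; rewrite (leaves_rotations vin); split=> //.
  by apply: contraTneq vin => ->; rewrite rotations_irr.
have in_r u : u \in [seq Node l r' | r' <- rotations r] -> left_subtree u = l.
  by case/mapP => v _ ->.
have in_ll u : u \in (if l is Node l1 l2 then [:: Node l1 (Node l2 r)] else [::]) ->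
    leaves (left_subtree u) < leaves l.
  case: (l) => //= l1 l2; rewrite inE => /eqP -> /=.
  by have := leaves_gt0 l2; lia.
have in_rr u : u \in (if r is Node r1 r2 then [:: Node (Node l r1) r2] else [::]) ->
    leaves l < leaves (left_subtree u).
  case: (r) => //= l1 l2; rewrite inE => /eqP -> /=.
  by have := leaves_gt0 l1; lia.
rewrite !cat_uniq !map_inj_uniq ?IHl ?IHr; try by move=> ? ? [].
rewrite !andTb; apply/and5P; split.
- apply/hasPn => u; rewrite !mem_cat => h; apply/negP => /in_l[e ne].
  by case/or3P: h => [/in_r e'|/in_ll|/in_rr]; [rewrite e' eqxx in ne|lia|lia].
- apply/hasPn => u; rewrite mem_cat => h; apply/negP => /in_r e.
  by case/orP: h => [/in_ll|/in_rr]; rewrite e ltnn.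
- by case: (l).
- by apply/hasPn => u /in_rr h; apply/negP => /in_ll; lia.
- by case: (r).
Qed.

Definition interval_edge (t : btree) (c p q : nat) : bool :=
  (q == p.+1) || ((p, q) \in intervals t c).

(** [d] and [d'] are the two diagonals of the quadrilateral i, j, k, l in
    one of the two orders, written with an arbitrary pairing [f], so that
    the same notion serves for intervals and for segments of the polygon. *)
Definition quad_diagonals (S : Type) (f : nat -> nat -> S) (i j k l : nat) (d d' : S) :=
  (d = f i k /\ d' = f j l) \/ (d = f j l /\ d' = f i k).

Lemma interval_edge_root t c : interval_edge t c c (c + leaves t).
Proof.
rewrite /interval_edge; case: t => [|l r]; first by rewrite addn1 eqxx.
by rewrite intervals_root ?orbT //=; have := leaves_gt0 l; have := leaves_gt0 r; lia.
Qed.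

(** The interval that disappears is never the base, so on triangulations it
    differs from its image under the half turn, and the rotation becomes a
    double flip. *)
Lemma intervals_rotation t t' c : t' \in rotations t ->
  exists i j k l d d',
  [/\ [&& c <= i, i < j, j < k, k < l & l <= c + leaves t],
      [&& interval_edge t c i j, interval_edge t c j k, interval_edge t c k l
        & interval_edge t c i l],
      quad_diagonals pair i j k l d d',
      (d \in intervals t c) && (d != (c, c + leaves t)) &
      intervals t' c =i [predU1 d' & [predD1 intervals t c & d]]].
Proof.
elim: t t' c => // l IHl r IHr t' c /=; rewrite !mem_cat.
have l0 := leaves_gt0 l; have r0 := leaves_gt0 r.
case/or4P=> [/mapP[u uin ->]|/mapP[u uin ->]|h|h].
- have [i [j [k [x [d [d' [/and5P[ci ij jk kx xb] edges dd' /andP[din droot] eqi]]]]]]] :=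
    IHl _ c uin.
  have up p q : interval_edge l c p q -> interval_edge (Node l r) c p q.
    by rewrite /interval_edge /= inE mem_cat => /orP[|] ->; rewrite ?orbT.
  exists i, j, k, x, d, d'; split=> //.
  + by apply/and5P; split=> //; lia.
  + by case/and4P: edges => *; rewrite !up.
  + rewrite inE mem_cat din orbT; case: (d) din => p q /intervals_bounds[? ? ?].
    by rewrite xpair_eqE; lia.
  move=> [p q] /=; rewrite !inE !mem_cat (leaves_rotations uin) eqi !inE.
  case: (eqVneq (p, q) d) => [e|ne] /=; last first.
    by case: (_ == d'); rewrite ?orbT.
  rewrite -e in din *; have [? ? ?] := intervals_bounds din.
  have -> : ((p, q) \in intervals r (c + leaves l)) = false.
    by apply/negP => /intervals_bounds[]; lia.
  by rewrite !orbF xpair_eqE; case: (_ == d'); rewrite ?orbT //=; lia.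
- have [i [j [k [x [d [d' [/and5P[ci ij jk kx xb] edges dd' /andP[din droot] eqi]]]]]]] :=
    IHr _ (c + leaves l) uin.
  have up p q : interval_edge r (c + leaves l) p q -> interval_edge (Node l r) c p q.
    by rewrite /interval_edge /= inE mem_cat => /orP[|] ->; rewrite ?orbT.
  exists i, j, k, x, d, d'; split=> //.
  + by apply/and5P; split=> //; lia.
  + by case/and4P: edges => *; rewrite !up.
  + rewrite inE mem_cat din !orbT; case: (d) din => p q /intervals_bounds[? ? ?].
    by rewrite xpair_eqE; lia.
  move=> [p q] /=; rewrite !inE !mem_cat (leaves_rotations uin) eqi !inE.
  case: (eqVneq (p, q) d) => [e|ne] /=; last first.
    by case: (_ == d'); rewrite ?orbT.
  rewrite -e in din *; have [? ? ?] := intervals_bounds din.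
  have -> : ((p, q) \in intervals l c) = false.
    by apply/negP => /intervals_bounds[]; lia.
  by rewrite !orbF xpair_eqE; case: (_ == d'); rewrite ?orbT //=; lia.
- case: l h l0 {IHl} => // l1 l2; rewrite inE => /eqP -> _.
  have l10 := leaves_gt0 l1; have l20 := leaves_gt0 l2.
  exists c, (c + leaves l1), (c + leaves l1 + leaves l2),
    (c + leaves (Node (Node l1 l2) r)).
  exists (c, c + leaves l1 + leaves l2),
    (c + leaves l1, c + leaves (Node (Node l1 l2) r)).
  have e1 := interval_edge_root l1 c; have e2 := interval_edge_root l2 (c + leaves l1).
  have e3 := interval_edge_root r (c + leaves l1 + leaves l2).
  rewrite /interval_edge /= !addnA in e1 e2 e3 *.
  rewrite ?inE ?mem_cat ?inE ?mem_cat; split; last first.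
  + move=> [p q]; rewrite !inE !mem_cat !inE !mem_cat.
    have b1 := @intervals_bounds l1 c p q.
    have b2 := @intervals_bounds l2 (c + leaves l1) p q.
    have b3 := @intervals_bounds r (c + leaves l1 + leaves l2) p q.
    case: (_ \in intervals l1 _) b1 => b1; first by have [? ? ?] := b1 isT; rewrite !xpair_eqE; lia.
    case: (_ \in intervals l2 _) b2 => b2; first by have [? ? ?] := b2 isT; rewrite !xpair_eqE; lia.
    case: (_ \in intervals r _) b3 => b3; first by have [? ? ?] := b3 isT; rewrite !xpair_eqE; lia.
    by rewrite !xpair_eqE; lia.
  + by rewrite !xpair_eqE; lia.
  + by left.
  + by rewrite eqxx; case/orP: e1 => ->; case/orP: e2 => ->; case/orP: e3 => ->; rewrite ?orbT.
  + by lia.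
- case: r h r0 {IHr} => // r1 r2; rewrite inE => /eqP -> _.
  have r10 := leaves_gt0 r1; have r20 := leaves_gt0 r2.
  exists c, (c + leaves l), (c + leaves l + leaves r1),
    (c + leaves (Node l (Node r1 r2))).
  exists (c + leaves l, c + leaves (Node l (Node r1 r2))), (c, c + leaves l + leaves r1).
  have e1 := interval_edge_root l c; have e2 := interval_edge_root r1 (c + leaves l).
  have e3 := interval_edge_root r2 (c + leaves l + leaves r1).
  rewrite /interval_edge /= !addnA in e1 e2 e3 *.
  rewrite ?inE ?mem_cat ?inE ?mem_cat; split; last first.
  + move=> [p q]; rewrite !inE !mem_cat !inE !mem_cat.
    have b1 := @intervals_bounds l c p q.
    have b2 := @intervals_bounds r1 (c + leaves l) p q.
    have b3 := @intervals_bounds r2 (c + leaves l + leaves r1) p q.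
    case: (_ \in intervals l _) b1 => b1; first by have [? ? ?] := b1 isT; rewrite !xpair_eqE; lia.
    case: (_ \in intervals r1 _) b2 => b2; first by have [? ? ?] := b2 isT; rewrite !xpair_eqE; lia.
    case: (_ \in intervals r2 _) b3 => b3; first by have [? ? ?] := b3 isT; rewrite !xpair_eqE; lia.
    by rewrite !xpair_eqE; lia.
  + by rewrite !xpair_eqE; lia.
  + by right.
  + by rewrite eqxx; case/orP: e1 => ->; case/orP: e2 => ->; case/orP: e3 => ->; rewrite ?orbT.
  + by lia.
Qed.

(** * Segments of the polygon as pairs of integers *)

Section Cyclohedron.
Variable n : nat.
Local Notation N := (2 * n + 2).
Implicit Types (T : {set {set 'I_N}}) (t : btree).

Lemma order_gt0 : 0 < N. Proof. by rewrite addn2. Qed.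

(** Corners are labelled by all natural numbers modulo the number of sides.
    Any window of consecutive labels can then serve as a linear order of the
    corners, and the window that starts at an end of the diameter avoids all
    wrap-around. *)
Definition corner (p : nat) : 'I_N := Ordinal (ltn_pmod p order_gt0).

Lemma corner_addN p : corner (p + N) = corner p.
Proof. by apply/val_inj; rewrite /= modnDr. Qed.

Lemma corner_ord (i : 'I_N) : corner i = i.
Proof. by apply/val_inj; rewrite /= modn_small. Qed.

Lemma corner_inj c p q : c <= p < c + N -> c <= q < c + N -> corner p = corner q -> p = q.
Proof.
wlog pq : p q / p <= q.
  by move=> h hp hq e; case/orP: (leq_total p q) => pq; [|symmetry]; apply: h.
move=> hp hq /(congr1 val)/= /esym/eqP; rewrite eqn_mod_dvd // => /dvdnP[[|k]]; first lia.
by rewrite mulSn; lia.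
Qed.

Lemma corner_surj c (i : 'I_N) : exists2 p, c <= p < c + N & i = corner p.
Proof.
elim: c => [|c [p hp ->]]; first by exists i; rewrite ?corner_ord //= add0n.
have [e|ne] := eqVneq p c; first by exists (p + N); rewrite ?corner_addN //; lia.
by exists p => //; lia.
Qed.

Lemma ordS_corner p : ordS (corner p) = corner p.+1.
Proof. by apply/val_inj; rewrite /= -addn1 modnDml addn1. Qed.

Lemma half_turn_corner p : half_turn (corner p) = corner (p + n.+1).
Proof.
rewrite /half_turn; elim: n.+1 => [|m IH]; first by rewrite addn0.
by rewrite iterS IH ordS_corner -(addnS p m).
Qed.

Definition seg (p q : nat) : {set 'I_N} := [set corner p; corner q].

Lemma segC p q : seg p q = seg q p. Proof. exact: setUC. Qed.

Lemma seg_addNl p q : seg (p + N) q = seg p q.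
Proof. by rewrite /seg corner_addN. Qed.

Lemma seg_addNr p q : seg p (q + N) = seg p q.
Proof. by rewrite /seg corner_addN. Qed.

Lemma seg_inj c p q p' q' :
  c <= p -> p < q -> q < c + N -> c <= p' -> p' < q' -> q' < c + N ->
  seg p q = seg p' q' -> p = p' /\ q = q'.
Proof.
move=> cp pq qc cp' pq' qc' e.
have : corner p \in seg p' q' by rewrite -e set21.
have : corner q \in seg p' q' by rewrite -e set22.
have : corner p' \in seg p q by rewrite e set21.
rewrite !inE => /orP[] /eqP /(@corner_inj c) h1 /orP[] /eqP /(@corner_inj c) h2
  /orP[] /eqP /(@corner_inj c) h3; lia.
Qed.

Lemma half_turn_segE p q : half_turn_seg (seg p q) = seg (p + n.+1) (q + n.+1).
Proof. by rewrite /half_turn_seg /seg imsetU1 imset_set1 !half_turn_corner. Qed.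

Lemma half_turnK : involutive (@half_turn n).
Proof.
move=> i; have [p _ ->] := corner_surj 0 i; rewrite !half_turn_corner -addnA.
by rewrite (_ : n.+1 + n.+1 = N) ?corner_addN //; lia.
Qed.

Lemma half_turn_segK : involutive (@half_turn_seg n).
Proof.
move=> d; rewrite /half_turn_seg -imset_comp -[RHS]imset_id.
by apply: eq_imset => i /=; rewrite half_turnK.
Qed.

Lemma is_side_seg p q : p < q < p + N ->
  is_side (seg p q) = (q == p.+1) || (q.+1 == p + N).
Proof.
move=> pq; apply/existsP/orP => [[i]|].
  have [r hr ->] := corner_surj p i; rewrite ordS_corner => /eqP e.
  have [hr1|hr1] := ltnP r.+1 (p + N).
    by left; have [] := @seg_inj p p q r r.+1 _ _ _ _ _ _ e; lia.
  have er : r.+1 = p + N by lia.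
  right; move: e; rewrite er corner_addN [X in _ = X]setUC => e.
  by have [] := @seg_inj p p q p r _ _ _ _ _ _ e; lia.
case=> /eqP e; first by exists (corner p); rewrite ordS_corner e.
by exists (corner q); rewrite ordS_corner e corner_addN -/(seg q p) segC.
Qed.

Lemma is_diagonal_seg p q : p < q < p + N ->
  is_diagonal (seg p q) = (p + 2 <= q) && (q + 2 <= p + N).
Proof.
move=> pq; rewrite /is_diagonal is_side_seg // cards2.
have -> : (corner p == corner q) = false by apply/eqP => /(@corner_inj p); lia.
by lia.
Qed.

Lemma is_diagonalP c d : is_diagonal d ->
  exists p q, [/\ c <= p, p + 2 <= q, q + 2 <= p + N, q < c + N & d = seg p q].
Proof.
move=> diag; move: (diag); rewrite {1}/is_diagonal => /andP[/cards2P[i [j [ne e]]] _].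
have [p hp ei] := corner_surj c i; have [q hq ej] := corner_surj c j.
rewrite {i}ei {j}ej in ne e.
have {ne} ne : p != q by apply: contraNneq ne => ->.
rewrite e in diag *.
have [pq|qp] := ltnP p q.
  by exists p, q; move: diag; rewrite is_diagonal_seg; [|lia] => /andP[]; split=> //; lia.
exists q, p; move: diag; rewrite -/(seg p q) segC is_diagonal_seg; last lia.
by move=> /andP[]; split=> //; lia.
Qed.

Lemma crossingC (d d' : {set 'I_N}) : crossing d d' = crossing d' d.
Proof. by rewrite /crossing orbC. Qed.

(** Crossing is defined with the labels of a fixed linear order. It does not
    depend on where that order starts: moving the first corner of the window
    to its end only exchanges the roles of the two segments. *)
Lemma crossing_quad c d d' : crossing d d' ->
  exists p r q s, [/\ c <= p, p < r, r < q, q < s & s < c + N] /\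
                  quad_diagonals seg p r q s d d'.
Proof.
move=> cr; elim: c => [|c [p [r [q [s [[cp pr rq qs sc] qd]]]]]].
  case/orP: cr => /existsP[i /existsP[j /existsP[k /existsP[l]]]].
    case/and5P=> ij jk kl /eqP-> /eqP->; exists i, j, k, l; split.
      by split=> //; rewrite add0n.
    by left; rewrite /seg !corner_ord.
  case/and5P=> ij jk kl /eqP-> /eqP->; exists i, j, k, l; split.
    by split=> //; rewrite add0n.
  by right; rewrite /seg !corner_ord.
have [e|ne] := eqVneq p c; last by exists p, r, q, s; split=> //; split=> //; lia.
exists r, q, s, (p + N); split; first by split=> //; lia.
by rewrite /quad_diagonals seg_addNr (segC q p); case: qd => -[-> ->]; [right|left].
Qed.

(** The converse of [crossing_quad]. As long as the last label is too large,
    it is brought to the front by subtracting the number of sides. *)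
Lemma crossing_seg p r q s : p < r -> r < q -> q < s -> s < p + N ->
  crossing (seg p q) (seg r s).
Proof.
elim/ltn_ind: s p r q => s IH p r q pr rq qs sp.
have [sN|sN] := ltnP s N.
  apply/orP; left; apply/existsP; exists (corner p); apply/existsP; exists (corner r).
  apply/existsP; exists (corner q); apply/existsP; exists (corner s).
  rewrite !eqxx !andbT /= !modn_small; lia.
rewrite crossingC (_ : seg r s = seg (s - N) r); last first.
  by rewrite segC -[in RHS]seg_addNl subnK.
apply: IH; lia.
Qed.

Lemma crossing_segP p q d' : p < q < p + N -> crossing (seg p q) d' ->
  exists r s, [/\ p < r, r < q, q < s, s < p + N & d' = seg r s].
Proof.
move=> pq /(crossing_quad p)[p1 [r [q1 [s [[? ? ? ? ?] [[e e']|[e e']]]]]]].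
  have [] := @seg_inj p p q p1 q1 _ _ _ _ _ _ e; try lia.
  by move=> e1 e2; exists r, s; split=> //; lia.
by have [] := @seg_inj p p q r s _ _ _ _ _ _ e; lia.
Qed.

Definition edge (T : {set {set 'I_N}}) p q := (seg p q \in T) || is_side (seg p q).

Lemma edgeC T p q : edge T p q = edge T q p. Proof. by rewrite /edge segC. Qed.

Lemma edge_addNr T p q : edge T p (q + N) = edge T p q.
Proof. by rewrite /edge seg_addNr. Qed.

Definition quad_edges T p r q s :=
  [&& edge T p r, edge T r q, edge T q s & edge T p s].

(** As for crossing, the quadrilateral of a flip can be listed from any
    starting point. *)
Lemma quad_flip_quad c T d d' : quad_flip T d d' ->
  d \in T /\
  exists p r q s, [/\ c <= p, p < r, r < q, q < s & s < c + N] /\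
    (quad_edges T p r q s /\ quad_diagonals seg p r q s d d').
Proof.
case/andP=> dT qf; split=> //.
elim: c => [|c [p [r [q [s [[cp pr rq qs sc] [qe qd]]]]]]].
  case/existsP: qf => i /existsP[j /existsP[k /existsP[l]]] /=.
  case/and5P=> ij jk kl edges dd; exists i, j, k, l; split.
    by split=> //; rewrite add0n.
  split; first by rewrite /quad_edges /edge /seg !corner_ord.
  rewrite /quad_diagonals /seg !corner_ord.
  by case/orP: dd => /andP[/eqP-> /eqP->]; [left|right].
have [e|ne] := eqVneq p c; last by exists p, r, q, s; split=> //; split=> //; lia.
exists r, q, s, (p + N); split; first by split=> //; lia.
split.
  rewrite /quad_edges !edge_addNr (edgeC T s) (edgeC T r p).
  by case/and4P: qe => -> -> -> ->.
by rewrite /quad_diagonals seg_addNr (segC q p); case: qd => -[-> ->]; [right|left].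
Qed.

Lemma quad_flip_seg T p r q s d d' :
  p < r -> r < q -> q < s -> s < p + N -> quad_edges T p r q s ->
  quad_diagonals seg p r q s d d' -> d \in T -> quad_flip T d d'.
Proof.
elim/ltn_ind: s p r q => s IH p r q pr rq qs sp qe qd dT.
have [sN|sN] := ltnP s N.
  rewrite /quad_flip dT /=; apply/existsP; exists (corner p); apply/existsP; exists (corner r).
  apply/existsP; exists (corner q); apply/existsP; exists (corner s).
  apply/and5P; split; [by rewrite /= !modn_small; lia..|by []|].
  by case: qd => -[-> ->]; rewrite !eqxx ?orbT.
have eS x : seg x s = seg (s - N) x by rewrite segC -[in RHS]seg_addNl subnK.
have eE x : edge T x s = edge T (s - N) x by rewrite /edge eS.
apply: (IH q _ (s - N) p r) => //; [lia..| |].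
  move: qe; rewrite /quad_edges !eE => /and4P[e1 e2 e3 e4].
  by apply/and4P.
by move: qd; rewrite /quad_diagonals eS => -[[-> ->]|[-> ->]]; [right|left].
Qed.

(** * Centrally symmetric triangulations *)

Lemma noncrossingP T :
  reflect ((forall d, d \in T -> is_diagonal d) /\
           (forall d d', d \in T -> d' \in T -> ~~ crossing d d'))
          (noncrossing T).
Proof.
apply: (iffP andP) => -[diag nc]; split.
- by move=> d dT; move/forallP/(_ d)/implyP: diag; apply.
- move=> d d' dT dT'; move/forallP/(_ d)/implyP/(_ dT): nc.
  by move/forallP/(_ d')/implyP; apply.
- by apply/forallP => d; apply/implyP => /diag.
- apply/forallP => d; apply/implyP => dT; apply/forallP => d'; apply/implyP => dT'.
  exact: nc.
Qed.

Lemma crossing_irr (d : {set 'I_N}) : ~~ crossing d d.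
Proof.
apply/negP => /(crossing_quad 0)[p [r [q [s [[_ pr rq qs sN]]]]]].
by case=> -[-> /(@seg_inj 0)[]]; lia.
Qed.

Lemma triangulationP T :
  reflect (noncrossing T /\
           forall d, is_diagonal d ->
             (forall d', d' \in T -> ~~ crossing d d') -> d \in T)
          (triangulation T).
Proof.
apply: (iffP maxsetP) => -[ncT maxT]; split=> //.
  move=> d diag ncd; rewrite -(maxT (d |: T)) ?setU11 ?subsetUr //.
  have [diagT ncTT] := noncrossingP _ ncT.
  apply/noncrossingP; split=> [d'|d1 d2]; rewrite !inE.
    by case/orP => [/eqP->|/diagT].
  case/orP => [/eqP->|d1T] /orP[/eqP->|d2T].
  - exact: crossing_irr.
  - exact: ncd.
  - by rewrite crossingC; apply: ncd.
  - exact: ncTT.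
move=> B /noncrossingP[diagB ncB] subB; apply/eqP; rewrite eqEsubset subB andbT.
apply/subsetP => d dB; apply: maxT; first exact: diagB.
by move=> d' /(subsetP subB); apply: ncB.
Qed.

Lemma edge_side T p q : p < q < p + N -> (q == p.+1) || (q.+1 == p + N) -> edge T p q.
Proof. by move=> pq h; rewrite /edge is_side_seg // h orbT. Qed.

Lemma edge_diagonal T p q : p + 2 <= q -> q + 2 <= p + N -> edge T p q = (seg p q \in T).
Proof. by move=> pq qp; rewrite /edge is_side_seg; [case: (_ \in _) => //=|]; lia. Qed.

(** The apex is the last corner k before q that is joined to p. If the
    segment from k to q were crossed by a segment of T, then that segment
    would cross [p, q] or [p, k], or it would end at p and contradict the
    choice of k; so maximality of T provides the segment from k to q. *)
Lemma apex T p q : triangulation T -> p + 2 <= q -> q < p + N -> edge T p q ->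
  exists k, [/\ p < k, k < q, edge T p k & edge T k q].
Proof.
move=> /triangulationP[/noncrossingP[diagT ncT] maxT] pq qp epq.
pose P k := [&& p < k, k < q & edge T p k].
have exP : exists k, P k.
  by exists p.+1; apply/and3P; split; [lia|lia|apply: edge_side; lia].
have ubP k : P k -> k <= q by case/and3P => *; lia.
case: (ex_maxnP exP ubP) => k /and3P[pk kq epk] maxk.
exists k; split=> //.
have [e|ne] := eqVneq q k.+1; first by apply: edge_side; lia.
rewrite /edge maxT //; first by rewrite is_diagonal_seg; lia.
move=> d' dT'; apply/negP => cr.
have {cr} [|r [s [kr rq qs sk ed']]] := crossing_segP _ cr; first lia.
rewrite {}ed' in dT'.
(* The segment crossing [k, q] has its second end before p, at p, or beyond
   p. *)
have [s1|s1|s1] := ltngtP s (p + N).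
- have := edge_diagonal T pq; rewrite epq => /(_ _)/esym hpq.
  have {}hpq : seg p q \in T by apply: hpq; lia.
  by have := ncT _ _ hpq dT'; rewrite crossing_seg; lia.
- have hpk : seg p k \in T by rewrite -edge_diagonal //; lia.
  have {}dT' : seg (s - N) r \in T by rewrite segC -[seg _ _]seg_addNr subnK //; lia.
  by have := ncT _ _ hpk dT'; rewrite crossing_seg; lia.
- have : P r.
    rewrite /P edgeC -edge_addNr -s1 /edge dT'; lia.
  by move/maxk; lia.
Qed.

(** Apices, taken recursively, read off the tree on one side of an edge. *)
Lemma edge_btree T p m : triangulation T -> 0 < m -> m + 2 <= N -> edge T p (p + m) ->
  exists2 t, leaves t = m & forall r s, (r, s) \in intervals t p -> seg r s \in T.
Proof.
move=> triT; elim/ltn_ind: m p => m IH p m0 mN e.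
have [m1|m1] := eqVneq m 1; first by exists Leaf => //.
have [||k [pk kq e1 e2]] := apex triT _ _ e; [lia..|].
have [||||l el hl] := IH (k - p) _ p; rewrite ?subnKC; [lia..|by []|lia|].
have [||||r er hr] := IH (p + m - k) _ k; rewrite ?subnKC; [lia..|by []|lia|].
exists (Node l r) => [/=|x y]; first lia.
rewrite inE mem_cat => /or3P[/eqP[-> ->]|/hl //|].
  have -> : p + leaves (Node l r) = p + m by move=> /=; lia.
  by rewrite -edge_diagonal //; lia.
by rewrite el subnKC ?(ltnW pk) // => /hr.
Qed.

Definition one_side (t : btree) (c : nat) : {set {set 'I_N}} :=
  [set d in [seq seg x.1 x.2 | x <- intervals t c]].

(** The triangulation made of the tree [t] on one side of the diameter at
    [c] and its image under the half turn on the other. The root of [t]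
    contributes the diameter itself, once from each side. *)
Definition symmetrized (t : btree) (c : nat) : {set {set 'I_N}} :=
  one_side t c :|: one_side t (c + n.+1).

Lemma one_sideP t c d :
  reflect (exists p q, (p, q) \in intervals t c /\ d = seg p q) (d \in one_side t c).
Proof.
rewrite inE; apply: (iffP mapP) => [[[p q] h ->]|[p [q [h ->]]]]; last by exists (p, q).
by exists p, q.
Qed.

Lemma one_side_addN t c : one_side t (c + N) = one_side t c.
Proof.
apply/setP => d; apply/one_sideP/one_sideP => -[p [q [h ->]]].
  have [? ? _] := intervals_bounds h.
  exists (p - N), (q - N); rewrite -(intervals_shift _ _ N) !subnK; [|lia..].
  by split=> //; rewrite -[RHS]seg_addNl -[RHS]seg_addNr !subnK //; lia.
by exists (p + N), (q + N); rewrite intervals_shift seg_addNl seg_addNr.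
Qed.

Lemma half_turn_one_side t c :
  [set half_turn_seg d | d in one_side t c] = one_side t (c + n.+1).
Proof.
apply/setP => d.
apply/imsetP/one_sideP => [[d1 /one_sideP[p [q [h ->]]] ->]|[p [q [h ->]]]].
  by exists (p + n.+1), (q + n.+1); rewrite half_turn_segE intervals_shift.
have [? ? _] := intervals_bounds h.
exists (seg (p - n.+1) (q - n.+1)).
  apply/one_sideP; exists (p - n.+1), (q - n.+1); split=> //.
  by rewrite -(intervals_shift _ _ n.+1) !subnK //; lia.
by rewrite half_turn_segE !subnK //; lia.
Qed.

Lemma symmetrized_shift t c : symmetrized t (c + n.+1) = symmetrized t c.
Proof.
by rewrite /symmetrized setUC -addnA (_ : n.+1 + n.+1 = N) ?one_side_addN //; lia.
Qed.

Lemma symmetrized_symmetric t c : centrally_symmetric (symmetrized t c).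
Proof.
rewrite /centrally_symmetric /symmetrized imsetU !half_turn_one_side setUC.
by rewrite -addnA (_ : n.+1 + n.+1 = N) ?one_side_addN //; lia.
Qed.

Definition diam (c : nat) : {set 'I_N} := seg c (c + n.+1).

Lemma diam_shift c : diam (c + n.+1) = diam c.
Proof.
by rewrite /diam segC -addnA (_ : n.+1 + n.+1 = N) ?seg_addNl //; lia.
Qed.

Lemma half_turn_diam c : half_turn_seg (diam c) = diam c.
Proof. by rewrite half_turn_segE -/(diam (c + n.+1)) diam_shift. Qed.

Lemma diam_unique T a b : noncrossing T -> diam a \in T -> diam b \in T ->
  a <= b < a + n.+1 -> a = b.
Proof.
move=> /noncrossingP[_ ncT] aT bT ab; have := ncT _ _ aT bT.
by case: (eqVneq a b) => // ne; rewrite crossing_seg; lia.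
Qed.

Hypothesis n_gt0 : 0 < n.

(** The only segment common to the two sides is the diameter, and that is
    the root interval. *)
Lemma symmetrized_intervals t c p q : leaves t = n.+1 ->
  c <= p -> p < q -> q <= c + n.+1 ->
  (seg p q \in symmetrized t c) = ((p, q) \in intervals t c).
Proof.
move=> et cp pq qc; apply/idP/idP => [|h]; last first.
  by rewrite inE; apply/orP; left; apply/one_sideP; exists p, q.
rewrite inE => /orP[] /one_sideP[r [s [h]]]; have [? ? ?] := intervals_bounds h.
  by move/(@seg_inj c)=> [||||||-> ->]; rewrite ?h //; lia.
have [sN|sN] := eqVneq s (c + N).
  rewrite sN seg_addNr [seg _ c]segC => /(@seg_inj c)=> -[||||||ep eq]; [lia..|].
  (* The interval comes from the other side and ends at c, so it joins c to
     a corner beyond c + n: it is the diameter. *)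
  have -> : p = c by [].
  have -> : q = c + leaves t by lia.
  by rewrite intervals_root // et.
by move/(@seg_inj c)=> -[||||||? ?]; lia.
Qed.

Lemma diam_symmetrized t c : leaves t = n.+1 -> diam c \in symmetrized t c.
Proof.
move=> et; rewrite symmetrized_intervals //; [|lia..].
by rewrite -[n.+1]et intervals_root // et.
Qed.

(** A crossing segment starts strictly inside one side; since it belongs to
    the triangulation, it stays in that side, where laminarity of the
    intervals applies. *)
Lemma one_side_noncrossing t c d d' : leaves t = n.+1 ->
  d \in one_side t c -> d' \in symmetrized t c -> ~~ crossing d d'.
Proof.
move=> et /one_sideP[p [q [h ->]]] dT'; apply/negP => cr.
have [b1 b2 b3] := intervals_bounds h.
have [|r [s [pr rq qs sp ed]]] := crossing_segP _ cr; first lia.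
have [s1|s1] := leqP s (c + n.+1).
  have {}dT' : (r, s) \in intervals t c.
    by rewrite -symmetrized_intervals -?ed //; lia.
  by have := intervals_laminar h dT'; lia.
have [s2|s2] := leqP (c + N) s.
  have {}ed : d' = seg (s - N) r by rewrite ed segC -[RHS]seg_addNl subnK //; lia.
  have {}dT' : (s - N, r) \in intervals t c.
    by rewrite -symmetrized_intervals -?ed //; lia.
  by have := intervals_laminar dT' h; lia.
move: dT'; rewrite inE ed => /orP[] /one_sideP[r' [s' [h']]];
  have [? ? ?] := intervals_bounds h'.
  by move/(@seg_inj c)=> -[||||||? ?]; lia.
have [sN|sN] := eqVneq s' (c + N).
  by rewrite sN seg_addNr [seg _ c]segC => /(@seg_inj c)=> -[||||||? ?]; lia.
by move/(@seg_inj c)=> -[||||||? ?]; lia.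
Qed.

Lemma one_side_maximal t c p q : leaves t = n.+1 ->
  c <= p -> p + 2 <= q -> q <= c + n.+1 ->
  (forall d', d' \in symmetrized t c -> ~~ crossing (seg p q) d') ->
  seg p q \in symmetrized t c.
Proof.
move=> et cp pq qc nc; rewrite symmetrized_intervals //; [|lia..].
apply: intervals_maximal; rewrite ?et // => r s h.
have [? ? ?] := intervals_bounds h.
have hs : seg r s \in symmetrized t c by rewrite symmetrized_intervals //; lia.
have := nc _ hs => ncr; apply/andP; split; apply: contra ncr => /and3P[? ? ?].
  by apply: crossing_seg; lia.
by rewrite crossingC; apply: crossing_seg; lia.
Qed.

(** A segment that does not cross the diameter lies on one side of it, where
    [intervals_maximal] applies. *)
Lemma symmetrized_triangulation t c : leaves t = n.+1 ->
  triangulation (symmetrized t c).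
Proof.
move=> et; apply/triangulationP; split.
  apply/noncrossingP; split=> [d|d d'].
    rewrite inE => /orP[] /one_sideP[p [q [/intervals_bounds[? ? ?] ->]]];
    by rewrite is_diagonal_seg; lia.
  rewrite {1}/symmetrized inE => /orP[] dh dT'.
    exact: one_side_noncrossing dh dT'.
  rewrite -symmetrized_shift in dT'.
  exact: one_side_noncrossing dh dT'.
move=> d /(is_diagonalP c)[p [q [cp pq qp qc ->]]] nc.
have [q1|q1] := leqP q (c + n.+1); first exact: one_side_maximal.
have [p1|p1] := leqP (c + n.+1) p.
  rewrite -symmetrized_shift in nc *.
  by apply: one_side_maximal => //; lia.
have [pc|pc] := eqVneq p c.
  rewrite -symmetrized_shift segC -(seg_addNr q p) in nc *.
  by apply: one_side_maximal => //; lia.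
have := nc _ (diam_symmetrized c et).
by rewrite crossingC crossing_seg; lia.
Qed.

(** The tree found on one side and its half turn form a maximal noncrossing
    set inside T, which must be T. *)
Lemma symmetrizedP T c : triangulation T -> centrally_symmetric T -> diam c \in T ->
  exists2 t, leaves t = n.+1 & T = symmetrized t c.
Proof.
move=> triT /eqP symT cT.
have [|||t et ht] := @edge_btree T c n.+1 triT; [lia..| |].
  by rewrite /edge cT.
exists t => //.
have [ncT _] := triangulationP _ triT.
have /maxsetP[_ maxS] := symmetrized_triangulation c et.
apply: maxS => //; apply/subsetP => d.
have sub : one_side t c \subset T.
  by apply/subsetP => d1 /one_sideP[p [q [h ->]]]; apply: ht.
rewrite inE -half_turn_one_side -symT => /orP[dh|].
  by rewrite symT; apply: (subsetP sub).
by apply/subsetP; apply: imsetS.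
Qed.

Lemma edge_half_turn T p q : centrally_symmetric T -> edge T p q ->
  p < q < p + N -> edge T (p + n.+1) (q + n.+1).
Proof.
move=> /eqP symT; rewrite /edge => /orP[h|side] pq.
  by rewrite -half_turn_segE -{1}symT imset_f.
apply/orP; right; move: side; rewrite !is_side_seg //; lia.
Qed.

(** Take a longest edge [p, q] that spans at most half of the polygon, and
    the apex k of the triangle on its far side. If [p, q] is not a diameter,
    then wherever k lies, one of the other two sides either is longer and
    still spans at most half of the polygon, or crosses the image of [p, q]
    under the half turn. *)
Lemma exists_diam T : triangulation T -> centrally_symmetric T ->
  exists c, diam c \in T.
Proof.
move=> triT symT.
have [/noncrossingP[_ ncT] _] := triangulationP _ triT.
pose P m := (0 < m <= n.+1) && [exists p : 'I_N, edge T p (p + m)].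
have intro_P x y : x < y -> y <= x + n.+1 -> edge T x y -> P (y - x).
  move=> xy yx e; apply/andP; split; first lia.
  apply/existsP; exists (corner x); move: e; rewrite /edge /seg corner_ord.
  rewrite (_ : corner (corner x + (y - x)) = corner y) //.
  by apply/val_inj; rewrite /= modnDml subnKC // ltnW.
have exP : exists m, P m.
  exists (1 - 0); apply: intro_P => //; apply: edge_side => //; lia.
have ubP m : P m -> m <= n.+1 by case/andP => /andP[].
case: (ex_maxnP exP ubP) => m /andP[/andP[m0 mn] /existsP[/= p0]].
move: (nat_of_ord p0) => p {p0} epq maxm.
have {}intro_P x y : x < y -> y <= x + n.+1 -> edge T x y -> y - x <= m.
  by move=> *; apply/maxm/intro_P.
have [em|nm] := eqVneq m n.+1.
  by exists p; rewrite -edge_diagonal -?em //; lia.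
have [|||k [qk kp e1 e2]] := @apex T (p + m) (p + N) triT; [lia..| |].
  by rewrite edge_addNr edgeC.
(* The edge from k to p is then longer than [p, q], which goes from p to p +
   m < k. *)
have [k1|k1] := leqP k (p + n.+1).
  by rewrite edge_addNr edgeC in e2; have := intro_P _ _ _ _ e2; lia.
(* Likewise for the edge from k to q. *)
have [k2|k2] := leqP (p + m + n.+1) k.
  by rewrite edgeC -edge_addNr in e1; have := intro_P _ _ _ _ e1; lia.
(* In the remaining case k lies strictly between the two ends of the image
   of [p, q], so the edge from q to k crosses this image. *)
have e3 := edge_half_turn symT epq ltac:(lia).
rewrite !edge_diagonal in e1 e3; [|lia..].
by have := ncT _ _ e1 e3; rewrite crossing_seg; lia.
Qed.

Lemma symmetrized_injl t t' c : leaves t = n.+1 -> leaves t' = n.+1 ->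
  symmetrized t c = symmetrized t' c -> t = t'.
Proof.
move=> et et' e; apply: (@intervals_inj _ _ c); first by rewrite et.
move=> [p q] h; have [? ? ?] := intervals_bounds h.
have : seg p q \in symmetrized t c by rewrite symmetrized_intervals //; lia.
by rewrite e symmetrized_intervals //; lia.
Qed.

Lemma symmetrized_inj t t' a b : leaves t = n.+1 -> leaves t' = n.+1 ->
  a < n.+1 -> b < n.+1 -> symmetrized t a = symmetrized t' b -> t = t' /\ a = b.
Proof.
move=> et et' an bn e.
have [nc _] := triangulationP _ (symmetrized_triangulation a et).
have da := diam_symmetrized a et.
have db := diam_symmetrized b et'; rewrite -e in db.
have eab : a = b.
  have [ab|ba] := leqP a b; first by apply: diam_unique nc da db _; lia.
  by symmetry; apply: diam_unique nc db da _; lia.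
by split=> //; apply: (symmetrized_injl et et' (c := a)); rewrite e eab.
Qed.

(** * Flips *)

Local Notation flipped := (@half_turn_seg n).

Lemma quad_flip_crossing T d d' : quad_flip T d d' -> crossing d d'.
Proof.
case/(quad_flip_quad 0) => _ [p [r [q [s [[_ pr rq qs sN] [_ qd]]]]]].
have cr : crossing (seg p q) (seg r s) by apply: crossing_seg; lia.
by case: qd => -[-> ->]; [exact: cr|rewrite crossingC; exact: cr].
Qed.

Lemma quad_flip_notin T d d' : noncrossing T -> quad_flip T d d' -> d' \notin T.
Proof.
move=> /noncrossingP[_ ncT] qf; apply/negP => d'T.
have dT : d \in T by case/andP: qf.
by have := ncT _ _ dT d'T; rewrite (quad_flip_crossing qf).
Qed.

(** The flip back uses the same quadrilateral. Its sides all meet [d] and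
    differ from it, hence the hypothesis that such segments survive in [T']. *)
Lemma quad_flip_sym T T' d d' : quad_flip T d d' -> d' \in T' ->
  (forall e, e \in T -> e != d -> ~~ [disjoint e & d] -> e \in T') ->
  quad_flip T' d' d.
Proof.
case/(quad_flip_quad 0) => _ [p [r [q [s [[_ pr rq qs sN] [qe qd]]]]]] d'T' keep.
have {}keep x y : edge T x y -> seg x y != d -> ~~ [disjoint seg x y & d] -> edge T' x y.
  move=> /orP[e ne nd|side _ _]; apply/orP; [left|by right].
  exact: keep.
have share x y z w : [|| x == z, x == w, y == z | y == w] ->
    ~~ [disjoint seg x y & seg z w].
  move=> h; apply/negP => /disjoint_setI0/setP dis.
  case/or4P: h => /eqP e.
  - by have := dis (corner x); rewrite !inE e eqxx.
  - by have := dis (corner x); rewrite !inE e eqxx ?orbT.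
  - by have := dis (corner y); rewrite !inE e eqxx ?orbT.
  - by have := dis (corner y); rewrite !inE e eqxx ?orbT.
have ne x y z w : x < y -> y < N -> z < w -> w < N -> (x, y) != (z, w) ->
    seg x y != seg z w.
  move=> xy yN zw wN; apply: contra => /eqP /(@seg_inj 0)[] //; try lia.
  by move=> -> ->.
case/and4P: qe => e1 e2 e3 e4.
apply: (@quad_flip_seg T' p r q s) => //; first lia.
  case: qd => -[ed _]; rewrite {}ed in keep.
    apply/and4P; split; apply: keep => //;
      by [apply: share; rewrite eqxx ?orbT | apply: ne; rewrite ?xpair_eqE; lia].
  apply/and4P; split; apply: keep => //;
    by [apply: share; rewrite eqxx ?orbT | apply: ne; rewrite ?xpair_eqE; lia].
by case: qd => -[-> ->]; [right|left].
Qed.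

Lemma half_turn_fixed p q : p < q < p + N -> flipped (seg p q) = seg p q ->
  q = p + n.+1.
Proof.
move=> pq; rewrite half_turn_segE => e.
have : corner (p + n.+1) \in seg p q by rewrite -e set21.
by rewrite !inE => /orP[] /eqP /(@corner_inj p); lia.
Qed.

Lemma half_turn_fixed_diam c d : is_diagonal d -> flipped d = d ->
  exists2 b, c <= b < c + n.+1 & d = diam b.
Proof.
move=> /(is_diagonalP c)[p [q [cp pq qp qc ->]]] /half_turn_fixed e.
have {}e : q = p + n.+1 by apply: e; lia.
by exists p; [lia|rewrite e].
Qed.

(** This keeps the sides of the quadrilateral around [d], which all meet
    [d], out of the pair of segments that a double flip removes. *)
Lemma half_turn_disjoint d : is_diagonal d -> flipped d != d ->
  [disjoint flipped d & d].
Proof.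
move=> /(is_diagonalP 0)[p [q [cp pq qp qc ->]]] ne.
apply/pred0P => i /=; apply/negP; rewrite half_turn_segE => /andP[h1 h2].
have flip_eq : corner (p + n.+1) = corner q -> False.
  move/(@corner_inj p) => e; move: ne; have -> : q = p + n.+1 by apply/esym/e; lia.
  by rewrite -/(diam p) half_turn_diam eqxx.
have noflip x : corner (x + n.+1) != corner x.
  by apply/eqP => /(@corner_inj x); lia.
move: h1 h2; rewrite !inE => /orP[] /eqP-> /orP[]; rewrite ?(negbTE (noflip _)) //.
  by move/eqP.
rewrite -half_turn_corner => /eqP/(congr1 (@half_turn n)).
by rewrite half_turnK half_turn_corner => /esym.
Qed.

Definition vertex_triangulation (T : b_vertex n) : triangulation (val T) :=
  proj1 (andP (valP T)).
Definition vertex_symmetric (T : b_vertex n) : centrally_symmetric (val T) :=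
  proj2 (andP (valP T)).
Lemma vertex_noncrossing (T : b_vertex n) : noncrossing (val T).
Proof. by have /triangulationP[] := vertex_triangulation T. Qed.
Lemma vertex_diagonal (T : b_vertex n) d : d \in val T -> is_diagonal d.
Proof. by have /noncrossingP[+ _] := vertex_noncrossing T; apply. Qed.

Lemma centrally_symmetric_mem T d : centrally_symmetric T ->
  (flipped d \in T) = (d \in T).
Proof.
move=> /eqP symT; rewrite -{1}symT.
by rewrite (mem_imset _ _ (can_inj (half_turn_segK))).
Qed.

Lemma single_flip_sym (T T' : b_vertex n) :
  single_flip (val T) (val T') -> single_flip (val T') (val T).
Proof.
case/existsP => d /existsP[d' /andP[qf /eqP eT']].
have dT : d \in val T by case/andP: qf.
have d'T := quad_flip_notin (vertex_noncrossing T) qf.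
apply/existsP; exists d'; apply/existsP; exists d; apply/andP; split.
  apply: (quad_flip_sym qf); first by rewrite eT' setU11.
  by move=> e eT ne _; rewrite eT' !inE eT ne orbT.
apply/eqP/setP => e; rewrite eT' !inE.
have [->|ne] := eqVneq e d; first by rewrite dT.
by have [->|ne'] := eqVneq e d'; rewrite ?(negbTE d'T).
Qed.

Lemma diam_double_flip (T T' : b_vertex n) d d' c :
  flipped d != d ->
  val T' = [set d'; flipped d'] :|: (val T :\: [set d; flipped d]) ->
  diam c \in val T -> diam c \in val T'.
Proof.
move=> ne -> cT; rewrite !inE cT andbT; apply/orP; right.
rewrite negb_or; apply/andP; split.
  by apply: contraNneq ne => <-; rewrite half_turn_diam.
apply: contraNneq ne => /(congr1 flipped).
by rewrite half_turn_segK half_turn_diam => <-; rewrite half_turn_diam.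
Qed.

(** The point is that [d'] is not its own image. Otherwise it would be a
    diameter of [T'], hence equal to the diameter of [T], which the flip
    keeps; but [d'] is not in [T]. *)
Lemma double_flip_sym (T T' : b_vertex n) :
  double_flip (val T) (val T') -> double_flip (val T') (val T).
Proof.
case/existsP => d /existsP[d' /and4P[ne qf qf2 /eqP eT']].
have dT : d \in val T by case/andP: qf.
have sdT : flipped d \in val T by case/andP: qf2.
have d'T := quad_flip_notin (vertex_noncrossing T) qf.
have sd'T := quad_flip_notin (vertex_noncrossing T) qf2.
have dis := half_turn_disjoint (vertex_diagonal dT) ne.
have d'T' : d' \in val T' by rewrite eT' !inE eqxx.
have sd'T' : flipped d' \in val T' by rewrite eT' !inE eqxx orbT.
have keep e : e \in val T -> e != d -> e != flipped d -> e \in val T'.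
  by move=> eT n1 n2; rewrite eT' !inE (negbTE n1) (negbTE n2) eT orbT.
apply/existsP; exists d'; apply/existsP; exists d; apply/and4P; split.
- apply: contraNneq d'T => fix_d'.
  have [c cT] := exists_diam (vertex_triangulation T) (vertex_symmetric T).
  have cT' := diam_double_flip ne eT' cT.
  have [b cb eb] := half_turn_fixed_diam c (vertex_diagonal d'T') fix_d'.
  rewrite eb in d'T' *.
  by rewrite -(diam_unique (vertex_noncrossing T') cT' d'T' cb).
- apply: (quad_flip_sym qf) => // e eT n1 nd; apply: keep => //.
  by apply: contraNneq nd => ->.
- apply: (quad_flip_sym qf2) => // e eT n1 nd; apply: keep => //.
  by apply: contraNneq nd => ->; rewrite disjoint_sym.
apply/eqP/setP => e; rewrite eT' !inE.
have [->|n1] := eqVneq e d; first by rewrite dT.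
have [->|n2] := eqVneq e (flipped d); first by rewrite sdT.
have [->|n3] := eqVneq e d'; first by rewrite (negbTE d'T).
by have [->|n4] := eqVneq e (flipped d'); rewrite ?(negbTE sd'T).
Qed.

Lemma b_adj_sym : symmetric (@b_adj n).
Proof.
by move=> T T'; apply/idP/idP => /orP[/single_flip_sym|/double_flip_sym] h;
  apply/orP; [left|right|left|right].
Qed.

Lemma one_side_opposite t c p q : leaves t = n.+1 ->
  c <= p -> p < q -> q <= c + n.+1 -> q < p + n.+1 ->
  seg p q \notin one_side t (c + n.+1).
Proof.
move=> et cp pq qc short; apply/one_sideP => -[r [s [/intervals_bounds[? ? ?] e]]].
have [es|nes] := eqVneq s (c + N).
  by move: e; rewrite es seg_addNr [seg r c]segC => /(@seg_inj c)[||||||? ?]; lia.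
by move/(@seg_inj c): e => [||||||? ?]; lia.
Qed.

(** Exchanging one interval of the tree, other than the root, exchanges two
    segments that are images of each other, because the two sides only share
    the diameter. *)
Lemma symmetrized_exchange t t' c p q (d' : nat * nat) : leaves t = n.+1 ->
  (p, q) \in intervals t c -> q < p + n.+1 ->
  intervals t' c =i [predU1 d' & [predD1 intervals t c & (p, q)]] ->
  let d := seg p q in let e := seg d'.1 d'.2 in
  symmetrized t' c = [set e; flipped e] :|: (symmetrized t c :\: [set d; flipped d]).
Proof.
move=> et din short eqi d e.
have [cp pq qc] := intervals_bounds din.
have fl_inj := can_inj (half_turn_segK).
have half_eq : one_side t' c = e |: (one_side t c :\ d).
  apply/setP => f; rewrite !inE; apply/mapP/orP => [[[r s]]|].
    rewrite eqi !inE => /orP[/eqP ed' ->|/andP[ne rs] ->]; [by left; rewrite /e -ed'|right].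
    apply/andP; split; last by apply/mapP; exists (r, s).
    apply: contra ne => /eqP /= erp; have [? ? ?] := intervals_bounds rs.
    by have [||||||-> ->] := @seg_inj c r s p q _ _ _ _ _ _ erp; [lia..|].
  case=> [/eqP->|/andP[ne /mapP[x xin ex]]].
    by exists d' => //; rewrite eqi !inE eqxx.
  exists x => //; rewrite eqi !inE xin andbT; apply/orP; right.
  by apply: contraNneq ne => exd; rewrite ex exd.
have half_eq2 : one_side t' (c + n.+1) = flipped e |: (one_side t (c + n.+1) :\ flipped d).
  rewrite -!half_turn_one_side half_eq imsetU1; congr (_ |: _).
  apply/setP => f; rewrite -[f]half_turn_segK !inE !(mem_imset _ _ fl_inj).
  by rewrite !inE (inj_eq fl_inj).
have d_half2 : d \notin one_side t (c + n.+1) by apply: one_side_opposite; lia.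
have sd_half : flipped d \notin one_side t c.
  apply: contra d_half2; rewrite -half_turn_one_side => h.
  by rewrite -[d]half_turn_segK imset_f.
apply/setP => f; rewrite /symmetrized half_eq half_eq2 {half_eq half_eq2}.
rewrite ![in LHS]in_setU ![in RHS]in_setU !in_setD !in_set1 !in_setU !in_set1.
have [->|n1] := eqVneq f d.
  by rewrite (negbTE d_half2) /= andbF !orbF.
have [->|n2] := eqVneq f (flipped d); first by rewrite (negbTE sd_half) /= !orbF.
by case: (f == e) => //=; rewrite orbCA.
Qed.

Lemma interval_edge_symmetrized t c p q : leaves t = n.+1 ->
  c <= p -> p < q -> q <= c + n.+1 -> interval_edge t c p q ->
  edge (symmetrized t c) p q.
Proof.
move=> et cp pq qc /orP[/eqP e|h]; first by apply: edge_side; lia.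
by rewrite /edge symmetrized_intervals // h.
Qed.

Lemma quad_double_flip T p r q s d d' : centrally_symmetric T ->
  p < r -> r < q -> q < s -> s < p + N -> quad_edges T p r q s ->
  quad_diagonals seg p r q s d d' -> d \in T -> flipped d != d ->
  double_flip T ([set d'; flipped d'] :|: (T :\: [set d; flipped d])).
Proof.
move=> symT pr rq qs sp edges dd dT ne.
apply/existsP; exists d; apply/existsP; exists d'; rewrite ne eqxx andbT /=.
apply/andP; split; first exact: quad_flip_seg edges dd dT.
apply: (@quad_flip_seg T (p + n.+1) (r + n.+1) (q + n.+1) (s + n.+1)); try lia.
- by case/and4P: edges => *; apply/and4P; split; apply: edge_half_turn => //; lia.
- by case: dd => -[-> ->]; rewrite !half_turn_segE; [left|right].
- by rewrite centrally_symmetric_mem.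
Qed.

Lemma symmetrized_rotation t t' c : leaves t = n.+1 -> t' \in rotations t ->
  double_flip (symmetrized t c) (symmetrized t' c).
Proof.
move=> et /(intervals_rotation c)[i [j [k [l [[p q] [d' []]]]]]].
rewrite et => /and5P[ci ij jk kl lc] qe qd /andP[din dne] eqi.
have [cp pq qc] := intervals_bounds din; rewrite et in qc.
have short : q < p + n.+1 by move: dne; rewrite xpair_eqE; clear -cp pq qc; lia.
rewrite (symmetrized_exchange et din short eqi).
apply: (@quad_double_flip _ i j k l) => //.
- exact: symmetrized_symmetric.
- by clear -lc ci; lia.
- by case/and4P: qe => e1 e2 e3 e4; apply/and4P; split;
    apply: interval_edge_symmetrized => //; clear -ci ij jk kl lc; lia.
- by case: qd => -[] [-> ->] ->; [left|right].
- by rewrite symmetrized_intervals //; clear -pq; lia.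
apply/eqP => /half_turn_fixed e; have {}e : q = p + n.+1.
  by apply: e; clear -pq qc cp; lia.
by rewrite e ltnn in short.
Qed.

(** * Arcs of diameters and the flips that leave them *)

(** Ordered pairs are easier to count than the edges of [edge_boundary]; the
    two have the same number of elements. *)
Definition out_pairs (V : finType) (adj : rel V) (S : {set V}) : {set V * V} :=
  [set p | [&& p.1 \in S, p.2 \notin S & adj p.1 p.2]].

Local Notation V := (b_vertex n).

Definition vertex_set (T : V) : {set {set 'I_N}} := val T.

Lemma vertex_set_inj : injective vertex_set.
Proof. exact: val_inj. Qed.

Lemma vertex_symmetrized (T : V) c : diam c \in val T ->
  exists2 t, leaves t = n.+1 & val T = symmetrized t c.
Proof. exact: symmetrizedP (vertex_triangulation T) (vertex_symmetric T). Qed.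

Lemma symmetrized_vertex t c : leaves t = n.+1 -> {T : V | val T = symmetrized t c}.
Proof.
move=> et.
have h : triangulation (symmetrized t c) && centrally_symmetric (symmetrized t c).
  by rewrite symmetrized_triangulation ?symmetrized_symmetric.
by exists (exist (fun X => triangulation X && centrally_symmetric X) _ h).
Qed.

Definition diam_arc (b m : nat) : {set V} :=
  [set T : V | has (fun a => diam a \in vertex_set T) (iota b m)].

Lemma diam_arcP b m (T : V) :
  reflect (exists2 a, b <= a < b + m & diam a \in val T) (T \in diam_arc b m).
Proof.
by rewrite inE; apply: (iffP hasP) => -[a ha aT];
  exists a => //; move: ha; rewrite mem_iota.
Qed.

Lemma card_diam_arc b m : b + m <= n.+1 -> #|diam_arc b m| = m * size (btrees n.+1).
Proof.
move=> bm; rewrite cardE -(size_map vertex_set) -[m in RHS](size_iota b).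
rewrite -(size_allpairs (fun a t => symmetrized t a)).
apply/perm_size/uniq_perm.
- by rewrite (map_inj_uniq vertex_set_inj) enum_uniq.
- apply: allpairs_uniq; [exact: iota_uniq|exact: uniq_btrees|].
  move=> [a t] [a' t'] /allpairsP[[? ?] /= [ha ht [-> ->]]].
  move=> /allpairsP[[? ?] /= [ha' ht' [-> ->]]] e.
  rewrite !mem_iota !mem_btrees in ha ha' ht ht'.
  by have [||||-> ->] := symmetrized_inj _ _ _ _ e; [exact/eqP|exact/eqP|lia..|].
move=> X; apply/mapP/allpairsP => [[T]|[[a t] /= [ha ht ->]]].
  rewrite mem_enum => /diam_arcP[a ha /vertex_symmetrized[t et eT]] ->.
  by exists (a, t); rewrite /= mem_iota mem_btrees et.
rewrite mem_btrees in ht; have [T eT] := symmetrized_vertex a (eqP ht).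
exists T => //; rewrite mem_enum; apply/diam_arcP; exists a;
  first by rewrite mem_iota in ha.
by rewrite eT diam_symmetrized //; apply/eqP.
Qed.

Lemma card_vertex_ge : n.+1 * size (btrees n.+1) <= #|V|.
Proof. by rewrite -(@card_diam_arc 0) // max_card. Qed.

Lemma diam_arc_disjoint b m b' m' (T : V) : b + m <= b' -> b' + m' <= n.+1 ->
  T \in diam_arc b m -> T \notin diam_arc b' m'.
Proof.
move=> bm bm' /diam_arcP[a ha aT]; apply/negP => /diam_arcP[a' ha' aT'].
suff : a = a' by lia.
by apply: diam_unique (vertex_noncrossing T) aT aT' _; lia.
Qed.

(** One neighbour for each rotation of the tree. *)
Lemma degree_ge (T : V) : n.-1 <= degree (@b_adj n) T.
Proof.
have [c cT] := exists_diam (vertex_triangulation T) (vertex_symmetric T).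
have [t et eT] := vertex_symmetrized cT.
have -> : n.-1 = n.+1 - 2 by lia.
rewrite -et -size_rotations -(size_map (symmetrized^~ c)).
rewrite /degree cardE -(size_map vertex_set); apply: uniq_leq_size.
  rewrite map_inj_in_uniq ?uniq_rotations // => t1 t2 h1 h2.
  by apply: symmetrized_injl; rewrite // (leaves_rotations _ : leaves _ = leaves t).
move=> X /mapP[t' rot ->].
have et' : leaves t' = n.+1 by rewrite (leaves_rotations rot).
have [T' eT'] := symmetrized_vertex c et'; apply/mapP; exists T' => //.
rewrite mem_enum inE; apply/orP; right.
by rewrite eT eT'; apply: symmetrized_rotation.
Qed.

(** A flip that removes the diameter must put another segment that is its
    own image in its place, that is, another diameter; it starts at the apex
    of the triangle on the old one, which for a tree is given by the size of
    the left subtree. *)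
Lemma b_adj_diam (T T' : V) t a : leaves t = n.+1 -> val T = symmetrized t a ->
  b_adj T T' ->
  diam a \in val T' \/
  (diam (a + left_leaves t) \in val T' /\
   val T' = diam (a + left_leaves t) |: (val T :\ diam a)).
Proof.
move=> et eT.
have aT : diam a \in val T by rewrite eT diam_symmetrized.
case/orP; last first.
  case/existsP => d /existsP[d' /and4P[ne _ _ /eqP eT']]; left.
  exact: diam_double_flip ne eT' aT.
case/existsP => d /existsP[d' /andP[qf /eqP eT']].
have [ed|ne] := eqVneq d (diam a); last first.
  by left; rewrite eT' !inE aT (eq_sym (diam a) d) ne orbT.
have d'T := quad_flip_notin (vertex_noncrossing T) qf.
have d'T' : d' \in val T' by rewrite eT' setU11.
have fix_d' : flipped d' = d'.
  have : flipped d' \in val T'.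
    by rewrite centrally_symmetric_mem ?vertex_symmetric.
  rewrite eT' !inE => /orP[/eqP//|/andP[_]].
  by rewrite centrally_symmetric_mem ?vertex_symmetric // (negbTE d'T).
rewrite {}ed in qf eT'.
case/(quad_flip_quad a): qf => _ [p [r [q [s [[ap pr rq qs sa] [qe qd]]]]]].
case: qd => -[e ed']; last first.
  have [||||||ear _] := @seg_inj a a (a + n.+1) r s _ _ _ _ _ _ e;
    [clear -n_gt0 ap pr rq qs sa; lia..|].
  by clear -ap pr ear; lia.
have [||||||ep eq] := @seg_inj a a (a + n.+1) p q _ _ _ _ _ _ e;
  [clear -n_gt0 ap pr rq qs sa; lia..|].
subst p q.
have fixrs : s = r + n.+1 by apply: half_turn_fixed; [lia|rewrite -ed'].
have edge_interval x y : a <= x -> x < y -> y <= a + n.+1 -> edge (val T) x y ->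
    (y == x.+1) || ((x, y) \in intervals t a).
  move=> ax xy ya; rewrite /edge eT symmetrized_intervals // => /orP[->|].
    by rewrite orbT.
  by rewrite is_side_seg; clear -xy ax ya n_gt0; lia.
case/and4P: qe => e1 e2 _ _.
have er : r = a + left_leaves t.
  by apply: root_apex_unique; rewrite ?et //;
    apply: edge_interval => //; clear -pr rq; lia.
right; rewrite -er; move: d'T' eT'; rewrite ed' fixrs -/(diam r) => -> ->.
by split.
Qed.

(** In particular the outside neighbour is determined by T. *)
Lemma out_pairs_diam b m (T T' : V) : b + m <= n.+1 ->
  T \in diam_arc b m -> T' \notin diam_arc b m -> b_adj T T' ->
  exists a t, [/\ b <= a < b + m, leaves t = n.+1, val T = symmetrized t a,
    b + m <= a + left_leaves t < b + n.+1 &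
    val T' = diam (a + left_leaves t) |: (val T :\ diam a)].
Proof.
move=> bm /diam_arcP[a ha /vertex_symmetrized[t et eT]] nT' adj.
exists a, t; split=> //; case: (b_adj_diam et eT adj) => [aT'|[lT' eT']] //.
- by case/negP: nT'; apply/diam_arcP; exists a.
- have lt : 0 < left_leaves t < n.+1.
    rewrite -et; case: (t) et => [|l r] /=; first by lia.
    by have := leaves_gt0 l; have := leaves_gt0 r; lia.
  apply: contraR nT' => h; apply/diam_arcP.
  have {h} /orP[h|h] : (a + left_leaves t < b + m) || (b + n.+1 <= a + left_leaves t).
    by clear -h; lia.
    by exists (a + left_leaves t) => //; clear -h ha; lia.
  exists (a + left_leaves t - n.+1); first by clear -h ha lt bm; lia.
  by rewrite -diam_shift subnK //; clear -h; lia.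
- by case/negP: nT'; apply/diam_arcP; exists a.
Qed.

(** The diameters that leave the arc are among its last k ones; since moving
    forward by k is moving backward by n+1-k around the circle, they are
    also among its first n+1-k ones. *)
Lemma count_exits b m k : b + m <= n.+1 -> 0 < k < n.+1 ->
  count (fun a => b + m <= a + k < b + n.+1) (iota b m) <= minn k (n.+1 - k).
Proof.
move=> bm hk; rewrite leq_min -!size_filter.
have sub x y :
    (forall a, b <= a < b + m -> b + m <= a + k < b + n.+1 -> x <= a < x + y) ->
    size [seq a <- iota b m | b + m <= a + k < b + n.+1] <= y.
  move=> h; rewrite -[y](size_iota x); apply: uniq_leq_size.
    by rewrite filter_uniq ?iota_uniq.
  by move=> a; rewrite mem_filter !mem_iota => /andP[h1 h2]; apply: h.
by apply/andP; split; [apply: (sub (b + m - k))|apply: (sub b)] => a; lia.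
Qed.

Lemma card_out_pairs b m : b + m <= n.+1 ->
  #|out_pairs (@b_adj n) (diam_arc b m)| <= escape_count n.+1.
Proof.
move=> bm; pose cond a t := b + m <= a + left_leaves t < b + n.+1.
pose L := [seq symmetrized t a | a <- iota b m, t <- [seq t <- btrees n.+1 | cond a t]].
have sizeL : size L <= escape_count n.+1.
  rewrite size_allpairs_dep sumnE big_map.
  under eq_bigr => a _ do rewrite size_filter
    (count_by_left_leaves (fun k => b + m <= a + k < b + n.+1)) //.
  rewrite exchange_big /= /escape_count.
  rewrite big_seq [leqRHS]big_seq; apply: leq_sum => k; rewrite mem_index_iota => hk.
  rewrite -big_distrl /= leq_mul2r; apply/orP; right.
  apply: leq_trans (count_exits bm hk).
  by rewrite -sum1_count [in X in _ <= X]big_mkcond leq_sum.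
apply: leq_trans sizeL; rewrite cardE -(size_map (fun p => vertex_set p.1)).
have out_sub p : p \in out_pairs (@b_adj n) (diam_arc b m) ->
  exists a t, [/\ a \in iota b m, t \in btrees n.+1, val p.1 = symmetrized t a, cond a t &
    val p.2 = diam (a + left_leaves t) |: (val p.1 :\ diam a)].
  rewrite inE => /and3P[h1 h2 h3].
  have [a [t [ha ht eT c12 eT']]] := out_pairs_diam bm h1 h2 h3.
  by exists a, t; split; rewrite ?mem_iota ?mem_btrees ?ht.
apply: uniq_leq_size.
  rewrite map_inj_in_uniq ?enum_uniq // => p p'; rewrite !mem_enum.
  case/out_sub => a [t [ha /[!mem_btrees]/eqP ht e1 _ e2]].
  case/out_sub => a' [t' [ha' /[!mem_btrees]/eqP ht' e1' _ e2']].
  rewrite !mem_iota in ha ha' => e.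
  have [||et ea] := symmetrized_inj ht ht' _ _ (etrans (esym e1) (etrans e e1')).
  - by lia.
  - by lia.
  case: p p' e e2 e2' {e1 e1'} => [p1 p2] [p1' p2'] /= e e2 e2'.
  congr pair; apply: vertex_set_inj; first exact: e.
  by move: e; rewrite /vertex_set /= e2 e2' et ea => ->.
move=> X /mapP[p]; rewrite mem_enum => /out_sub[a [t [ha ht e1 c12 _]]] ->.
apply/allpairsPdep; exists a, t; split=> //; by rewrite mem_filter c12.
Qed.

End Cyclohedron.

(** * Escape of the lazy walk from a set of vertices *)

Local Open Scope ring_scope.

Section Walk.
Variables (R : realType) (V : finType) (adj : rel V) (S : {set V}).
Hypothesis adj_sym : symmetric adj.

Local Notation P := (lazy_walk R adj).
Local Notation deg x := ((degree adj x)%:R : R).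

Lemma card_edge_boundary : (#|edge_boundary adj S| <= #|out_pairs adj S|)%N.
Proof.
apply: leq_trans (leq_imset_card (fun p : V * V => [set p.1; p.2]) _).
apply/subset_leq_card/fintype.subsetP => e /imset2P[x y xS].
rewrite !inE => /andP[yS xy] ->.
by apply/imsetP; exists (x, y); rewrite ?inE ?xS ?yS.
Qed.

Lemma degreeE x : deg x = \sum_y (adj x y)%:R.
Proof.
rewrite /degree cardsE -sum1_card natr_sum big_mkcond /=.
by apply: eq_bigr => y _; rewrite unfold_in; case: (adj x y).
Qed.

Lemma card_out_pairsE :
  #|out_pairs adj S|%:R = \sum_(x in S) \sum_(y in ~: S) (adj x y)%:R :> R.
Proof.
rewrite pair_big_dep /= -sum1_card natr_sum big_mkcond [RHS]big_mkcond /=.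
apply: eq_bigr => -[x y] _ /=; rewrite !inE /=.
by case: (x \in S); case: (y \in S); case: (adj x y).
Qed.

(** Stated so that it also holds at isolated vertices, where the quotient is
    0. *)
Lemma deg_mul_div (x : V) (a : R) : 0 <= a -> deg x * (a / deg x) <= a.
Proof.
move=> a0; have [->|d0] := eqVneq (deg x) 0; first by rewrite mul0r.
by rewrite mulrCA divff // mulr1.
Qed.

Lemma lazy_walk_ge0 x y : 0 <= P x y.
Proof. by rewrite /lazy_walk addr_ge0 // mulr_ge0 ?invr_ge0 // divr_ge0. Qed.

Lemma sum_pick (A : pred V) (x : V) : \sum_(y | A y) (x == y)%:R = (A x)%:R :> R.
Proof.
rewrite big_mkcond (bigD1 x) //= eqxx big1 ?addr0 => [|y /negbTE]; first by case: (A x).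
by rewrite eq_sym => ->; case: (A y).
Qed.

Lemma lazy_walk_sum (A : pred V) x :
  \sum_(y | A y) P x y = 2^-1 * (A x)%:R + 2^-1 * (\sum_(y | A y) (adj x y)%:R / deg x).
Proof. by rewrite big_split /= -!mulr_sumr sum_pick. Qed.

Lemma lazy_walk_sum_le1 x : \sum_y P x y <= 1.
Proof.
rewrite lazy_walk_sum /= -mulr_suml -degreeE.
have [->|d0] := eqVneq (deg x) 0; first by rewrite mul0r; lra.
by rewrite divff //; lra.
Qed.

Lemma law_ge0 x t y : 0 <= law_at P x t y.
Proof.
elim: t y => [|t IH] y; first by rewrite /law_at /=.
by rewrite /law_at iterS; apply: sumr_ge0 => z _; rewrite mulr_ge0 ?lazy_walk_ge0 ?IH.
Qed.

Lemma law_sum_le1 x t : \sum_y law_at P x t y <= 1.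
Proof.
elim: t => [|t IH].
  by rewrite /law_at /=; under eq_bigr do rewrite eq_sym; rewrite sum_pick.
rewrite /law_at iterS exchange_big /=; apply: le_trans IH; apply: ler_sum => y _.
by rewrite -mulr_sumr ler_piMr ?law_ge0 ?lazy_walk_sum_le1.
Qed.

(** The law at time [t] of the walk started in [S] with weights equal to the
    degrees, without normalisation. The degrees are an invariant measure, so
    this law stays below them forever. *)
Definition start_law (t : nat) : V -> R :=
  iter t (step P) (fun x => (x \in S)%:R * deg x).

Lemma start_lawS t y : start_law t.+1 y = \sum_x start_law t x * P x y.
Proof. by []. Qed.

Lemma law_atS x t y : law_at P x t.+1 y = \sum_z law_at P x t z * P z y.
Proof. by []. Qed.

Lemma start_lawE t y : start_law t y = \sum_(x in S) deg x * law_at P x t y.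
Proof.
elim: t y => [|t IH] y.
  rewrite /start_law /law_at /= big_mkcond (bigD1 y) //= eqxx big1 ?addr0 => [|x /negbTE].
    by case: (y \in S); rewrite ?mul0r ?mul1r ?mulr1.
  by rewrite eq_sym => ->; rewrite mulr0 if_same.
rewrite start_lawS; under eq_bigr do rewrite IH mulr_suml.
rewrite exchange_big; apply: eq_bigr => x _; rewrite law_atS mulr_sumr.
by apply: eq_bigr => z _; rewrite mulrA.
Qed.

Lemma start_law_bounds t y : 0 <= start_law t y <= deg y.
Proof.
elim: t y => [|t IH] y.
  by rewrite /start_law /=; case: (y \in S); rewrite ?mul0r ?mul1r lexx ?ler0n.
rewrite start_lawS; apply/andP; split.
  by apply: sumr_ge0 => x _; have /andP[? _] := IH x; rewrite mulr_ge0 ?lazy_walk_ge0.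
apply: (@le_trans _ _ (\sum_x (2^-1 * (deg x * (y == x)%:R) + 2^-1 * (adj y x)%:R))).
  apply: ler_sum => x _; have /andP[F0 Fd] := IH x.
  apply: (le_trans (ler_wpM2r (lazy_walk_ge0 x y) Fd)).
  rewrite /lazy_walk mulrDr mulrCA eq_sym lerD2l mulrCA ler_wpM2l ?invr_ge0 //.
  by rewrite (adj_sym y x) deg_mul_div.
rewrite big_split /= -!mulr_sumr -degreeE.
rewrite (bigD1 y) //= eqxx mulr1 big1 ?addr0; first by lra.
by move=> x /negbTE; rewrite eq_sym => ->; rewrite mulr0.
Qed.

(** A vertex x of [S] carries at most its degree, and passes half of this in
    equal shares to its neighbours; so each edge that leaves [S] carries at
    most 1/2. *)
Lemma start_law_escape t :
  \sum_(y in S) start_law t y - 2^-1 * #|out_pairs adj S|%:R <=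
  \sum_(y in S) start_law t.+1 y.
Proof.
rewrite card_out_pairsE mulr_sumr -sumrB.
have -> : \sum_(y in S) start_law t.+1 y = \sum_x start_law t x * \sum_(y in S) P x y.
  under eq_bigr do rewrite start_lawS.
  by rewrite exchange_big /=; apply: eq_bigr => x _; rewrite mulr_sumr.
rewrite [leRHS](bigID (mem S)) /= -[leLHS]addr0 lerD //; last first.
  apply: sumr_ge0 => x _; have /andP[? _] := start_law_bounds t x.
  by rewrite mulr_ge0 // sumr_ge0 // => y _; apply: lazy_walk_ge0.
apply: ler_sum => x xS; have /andP[F0 Fd] := start_law_bounds t x.
rewrite lazy_walk_sum xS mulr1 -mulr_suml.
have dE : deg x = \sum_(y in S) (adj x y)%:R + \sum_(y in ~: S) (adj x y)%:R.
  rewrite degreeE (bigID (mem S)) /=; congr (_ + _).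
  by apply: eq_bigl => y; rewrite !inE.
set a := \sum_(y in S) _ in dE *; set b := \sum_(y in ~: S) _ in dE *.
have b0 : 0 <= b by apply: sumr_ge0.
have [d0|d0] := eqVneq (deg x) 0.
  rewrite d0 in Fd; have -> : start_law t x = 0 by apply/eqP; rewrite eq_le Fd.
  by lra.
have d_gt0 : 0 < deg x by rewrite lt_def d0 ler0n.
have -> : a / deg x = 1 - b / deg x 
  by apply: (mulIf d0); rewrite mulrBl !divfK // mul1r dE addrK.
have : start_law t x * (b / deg x) <= b.
  by apply: le_trans (deg_mul_div x b0); rewrite ler_wpM2r // divr_ge0.
by nra.
Qed.

Lemma start_law_remains t :
  \sum_(x in S) deg x - t%:R * (2^-1 * #|out_pairs adj S|%:R) <=
  \sum_(y in S) start_law t y.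
Proof.
elim: t => [|t IH].
  rewrite mul0r subr0; apply: ler_sum => x xS.
  by rewrite /start_law /= xS mul1r.
by apply: le_trans (start_law_escape t); rewrite -natr1; lra.
Qed.

(** [mu] may have mass less than 1, as the walk loses mass at an isolated
    vertex. *)
Lemma tv_dist_ge (mu nu : V -> R) : \sum_x mu x <= 1 -> \sum_x nu x = 1 ->
  \sum_(x in S) mu x - \sum_(x in S) nu x <= tv_dist mu nu.
Proof.
rewrite (bigID (mem S)) /= [X in X = 1](bigID (mem S)) /= /tv_dist => h1 h2.
rewrite [X in 2^-1 * X](bigID (mem S)) /=.
have e1 : \sum_(x in S) mu x - \sum_(x in S) nu x <= \sum_(x in S) `|mu x - nu x|.
  by rewrite -sumrB; apply: ler_sum => x _; apply: ler_norm.
have e2 : \sum_(x | x \notin S) nu x - \sum_(x | x \notin S) mu x <=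
    \sum_(x | x \notin S) `|mu x - nu x|.
  by rewrite -sumrB; apply: ler_sum => x _; rewrite distrC; apply: ler_norm.
by lra.
Qed.

(** The mass of [start_law] is an average over starting points of [S], so
    once the walk is mixed a share of at least 1 - eps - pi(S) of it must have
    left [S], while [start_law_escape] bounds how fast it can leave. *)
Lemma mixing_escape (pi : V -> R) (eps : R) (t : nat) :
  \sum_x pi x = 1 -> mixed_from P pi eps t ->
  (\sum_(x in S) deg x) * (1 - eps - \sum_(x in S) pi x) <=
  t%:R * (2^-1 * #|out_pairs adj S|%:R).
Proof.
move=> pi1 mixed; have rem := start_law_remains t.
have up : \sum_(y in S) start_law t y <=
    (\sum_(x in S) deg x) * (eps + \sum_(x in S) pi x).
  under eq_bigr do rewrite start_lawE.
  rewrite exchange_big mulr_suml /=; apply: ler_sum => x _.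
  rewrite -mulr_sumr ler_wpM2l // -lerBlDr.
  apply: le_trans (tv_dist_ge (law_sum_le1 x t) pi1) _; apply: ltW.
  by apply: le_lt_trans (mixed t (leqnn t)); apply: le_bigmax.
by lra.
Qed.

End Walk.

(** * The two asymptotic bounds *)

Lemma disjoint_small_measure (R : realType) (V : finType) (K : nat)
    (S : 'I_K -> {set V}) (pi : V -> R) :
  (0 < K)%N -> (forall x, 0 <= pi x) -> \sum_x pi x = 1 ->
  (forall i j x, x \in S i -> x \in S j -> i = j) ->
  exists j, \sum_(x in S j) pi x <= K%:R^-1.
Proof.
move=> K0 pi0 pi1 disj; apply: contrapT => none.
have big j : K%:R^-1 < \sum_(x in S j) pi x.
  by rewrite ltNge; apply/negP => h; apply: none; exists j.
have total : \sum_j \sum_(x in S j) pi x <= 1.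
  rewrite -pi1 (exchange_big_dep xpredT) //=; apply: ler_sum => x _.
  rewrite sumr_const -mulr_natr ler_piMr // lern1.
  apply/card_le1_eqP => i j /= hi hj.
  by apply: (disj _ _ x); [exact: hj|exact: hi].
have : \sum_(j < K) K%:R^-1 < \sum_j \sum_(x in S j) pi x.
  case: K K0 S disj none big {total} => // K _ S _ _ big.
  by apply: ltr_sum => //; apply/hasP; exists ord0; rewrite ?mem_index_enum.
rewrite sumr_const card_ord -(mulr_natr K%:R^-1) mulVf ?pnatr_eq0 -?lt0n //.
by rewrite ltNge total.
Qed.

Section Asymptotics.
Variables (R : realType) (n : nat).
Hypothesis n_gt0 : (0 < n)%N.
Local Notation G := (size (btrees n.+1)).
Local Notation sqn := (Num.sqrt (n%:R : R)).

Lemma size_btrees_gt0 m : (0 < m)%N -> (0 < size (btrees m))%N.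
Proof.
case: m => // m _; elim: m => // m IH.
have := catalanS m; rewrite /catalan; case: (size (btrees m.+2)) => //; nia.
Qed.

Lemma card_out_pairs_sqrt b m : (b + m <= n.+1)%N ->
  #|out_pairs (@b_adj n) (diam_arc n b m)|%:R <= sqn * G%:R.
Proof.
move=> bm; apply: (@le_trans _ _ (escape_count n.+1)%:R).
  by rewrite ler_nat card_out_pairs.
rewrite -(@ler_pXn2r _ 2) ?nnegrE ?mulr_ge0 ?sqrtr_ge0 //.
by rewrite exprMn sqr_sqrtr // -!natrX -natrM ler_nat escape_count_le.
Qed.

Lemma expansion_bounds : 0 <= expansion R (@b_adj n) <= 2 * sqn^-1.
Proof.
have G0 := size_btrees_gt0 (ltn0Sn n).
(* An arc of half of the diameters gives half of the vertices at most. *)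
pose m := (n.+1)./2; have m_le : (0 + m <= n.+1)%N by rewrite /m; lia.
have cardS := card_diam_arc n_gt0 m_le; have cardV := card_vertex_ge n_gt0.
have m_gt0 : (0 < m)%N by rewrite /m; lia.
rewrite /expansion; set E := (X in inf X).
have inE : E (#|edge_boundary (@b_adj n) (diam_arc n 0 m)|%:R / #|diam_arc n 0 m|%:R).
  exists (diam_arc n 0 m); split=> //.
    by rewrite -card_gt0 cardS muln_gt0 m_gt0.
  rewrite cardS mulnA; apply: leq_trans cardV; rewrite leq_mul2r.
  by apply/orP; right; rewrite /m; lia.
have lbE : lbound E 0 by move=> _ [S [_ _ ->]]; rewrite divr_ge0.
apply/andP; split; first by apply: lb_le_inf lbE; exact: (ex_intro _ _ inE).
apply: le_trans (ge_inf _ inE) _; first by exists 0.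
rewrite cardS.
have bd : #|edge_boundary (@b_adj n) (diam_arc n 0 m)|%:R <= sqn * G%:R.
  apply: le_trans (card_out_pairs_sqrt m_le).
  by rewrite ler_nat card_edge_boundary.
have n_pos : 0 < n%:R :> R by rewrite ltr0n.
have sq_pos : 0 < sqn by rewrite sqrtr_gt0.
have sq2 : sqn * sqn = n%:R by rewrite -expr2 sqr_sqrtr ?ler0n.
have mn : n%:R <= 2 * m%:R :> R.
  by rewrite -natrM ler_nat /m; lia.
have G_pos : 0 < G%:R :> R by rewrite ltr0n.
have m_pos : 0 < m%:R :> R by rewrite ltr0n.
rewrite natrM ler_pdivrMr ?mulr_gt0 //; apply: le_trans bd _.
rewrite mulrA ler_pM2r // mulrAC ler_pdivlMr // sq2 //.
Qed.

Lemma vertex_measure_arc (pi : b_vertex n -> R) (K : nat) :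
  (0 < K)%N -> (forall x, 0 <= pi x) -> \sum_x pi x = 1 ->
  exists2 b, (b + n.+1 %/ K <= n.+1)%N &
    \sum_(x in diam_arc n b (n.+1 %/ K)) pi x <= K%:R^-1.
Proof.
move=> K0 pi0 pi1; set m := (n.+1 %/ K)%N.
have inside (j : nat) : (j < K)%N -> (j * m + m <= n.+1)%N.
  move=> jK; rewrite -mulSnr; apply: leq_trans (leq_trunc_div n.+1 K).
  by rewrite mulnC leq_mul2l jK orbT.
have apart (i j : 'I_K) x : (i < j)%N -> x \in diam_arc n (i * m) m ->
    x \notin diam_arc n (j * m) m.
  move=> ij; apply: (diam_arc_disjoint n_gt0); last exact: inside.
  by rewrite -mulSnr leq_mul2r ij orbT.
have disj (i j : 'I_K) x :
    x \in diam_arc n (i * m) m -> x \in diam_arc n (j * m) m -> i = j.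
  move=> hi hj; apply/val_inj; case: (ltngtP i j) => // h.
    by rewrite (negbTE (apart _ _ _ h hi)) in hj.
  by rewrite (negbTE (apart _ _ _ h hj)) in hi.
have [j small] := disjoint_small_measure K0 pi0 pi1 disj.
by exists (j * m)%N => //; apply: inside.
Qed.

(** The constant collects the estimates n-1 >= n/2 for the degrees and m >=
    n/(2K) for the length of the arc, and the share (1-eps)/2 of the mass
    that has to leave the arc. *)
Lemma mixing_time_ge (pi : b_vertex n -> R) (eps : R) (K t : nat) :
  0 < eps < 1 -> (0 < K)%N -> 2 * K%:R^-1 <= 1 - eps -> (K <= n)%N -> (1 < n)%N ->
  is_stationary (lazy_walk R (@b_adj n)) pi ->
  mixed_from (lazy_walk R (@b_adj n)) pi eps t ->
  (1 - eps) / (4 * K%:R) * (n%:R * sqn) <= t%:R.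
Proof.
move=> /andP[eps0 eps1] K0 K_eps Kn n1 [pi0 pi1 _] mixed.
have [b inside small] := vertex_measure_arc K0 pi0 pi1.
set m := (n.+1 %/ K)%N in inside small.
have := mixing_escape (diam_arc n b m) (b_adj_sym n_gt0) pi1 mixed.
have out := card_out_pairs_sqrt inside.
set S := diam_arc n b m in small out *; set p := \sum_(x in S) pi x in small *.
set vol := \sum_(x in S) _; set o := #|_|%:R in out * => main.
have G_pos : 0 < G%:R :> R by rewrite ltr0n size_btrees_gt0.
have vol_ge : (n%:R / 2) * (n%:R / (2 * K%:R)) * G%:R <= vol.
  have h1 : n.-1%:R * (m%:R * G%:R) <= vol.
    rewrite -natrM -(card_diam_arc n_gt0 inside) mulr_natr -sumr_const.
    by apply: ler_sum => x _; rewrite ler_nat degree_ge.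
  apply: le_trans h1; rewrite -mulrA; apply: ler_pM; rewrite ?mulr_ge0 ?invr_ge0 //.
    by rewrite ler_pdivrMr // -natrM ler_nat; lia.
  rewrite ler_pM2r // ler_pdivrMr ?mulr_gt0 ?ltr0n // -!natrM ler_nat.
  have := ltn_ceil n.+1 K0; rewrite -/m.
  have : (0 < m)%N by rewrite divn_gt0 //; lia.
  by nia.
have sq_pos : 0 < sqn by rewrite sqrtr_gt0 ltr0n.
have sq2 : sqn * sqn = n%:R by rewrite -expr2 sqr_sqrtr ?ler0n.
have K_pos : 0 < K%:R :> R by rewrite ltr0n.
have n_pos : 0 < n%:R :> R by rewrite ltr0n.
have slack : (1 - eps) / 2 <= 1 - eps - p by lra.
have vol_pos : 0 <= vol by apply: sumr_ge0.
rewrite -(@ler_pM2r _ (2^-1 * (sqn * G%:R))); last first.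
  by rewrite mulr_gt0 ?invr_gt0 // mulr_gt0.
apply: (@le_trans _ _ (t%:R * (2^-1 * o))); last first.
  by rewrite ler_wpM2l // ler_wpM2l // invr_ge0.
apply: le_trans main.
apply: (@le_trans _ _ ((n%:R / 2) * (n%:R / (2 * K%:R)) * G%:R * ((1 - eps) / 2))).
  rewrite le_eqVlt; apply/orP; left; apply/eqP.
  transitivity ((1 - eps) / (4 * K%:R) * n%:R * 2^-1 * G%:R * (sqn * sqn)); first by ring.
  by rewrite sq2; field; rewrite gt_eqF.
by apply: ler_pM => //; lra.
Qed.

End Asymptotics.

Local Open Scope classical_set_scope.

Theorem theorem1p2 (R : realType) :
  ((fun n : nat => expansion R (@b_adj n)) : nat -> R)
    =O_\oo (fun n : nat => (Num.sqrt (n%:R : R))^-1)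
  /\
  forall (eps : R) (pi : forall n : nat, b_vertex n -> R) (tau : nat -> nat),
    0 < eps < 1 ->
    (forall n : nat, (0 < n)%N ->
       is_stationary (lazy_walk R (@b_adj n)) (pi n)) ->
    (forall n : nat, (0 < n)%N ->
       is_mixing_time (lazy_walk R (@b_adj n)) (pi n) eps (tau n)) ->
    ((fun n : nat => (tau n)%:R) : nat -> R)
      =Omega_\oo (fun n : nat => (n%:R : R) `^ (3 / 2)).
Proof.
split.
  apply/eqO_exP; exists 2 => //; near=> n.
  have n_gt0 : (0 < n)%N by near: n; apply: nbhs_infty_ge.
  have /andP[h0 h2] := expansion_bounds R n_gt0.
  by rewrite ger0_norm // ger0_norm // invr_ge0 sqrtr_ge0.
move=> eps pi tau eps01 stat mix; have /andP[eps0 eps1] := eps01.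
pose K := (Num.truncn (2 / (1 - eps))).+1.
have d_pos : 0 < 1 - eps by rewrite subr_gt0.
have K_eps : 2 * K%:R^-1 <= 1 - eps.
  rewrite ler_pdivrMr ?ltr0n // mulrC -ler_pdivrMr //.
  by apply: ltW; apply: truncnS_gt.
rewrite eqOmegaE qualifE; apply/asboolP; exists ((1 - eps) / (4 * K%:R)).
  by rewrite divr_gt0 // mulr_gt0 ?ltr0n.
near=> n.
have Kn : (K <= n)%N by near: n; apply: nbhs_infty_ge.
have n1 : (1 < n)%N by near: n; apply: nbhs_infty_ge.
have n_gt0 : (0 < n)%N by apply: ltnW.
have -> : (n%:R : R) `^ (3 / 2) = n%:R * Num.sqrt n%:R.
  have -> : 3 / 2 = 1 + 2^-1 :> R by lra.
  by rewrite powRD ?powRr1 ?powR12_sqrt // pnatr_eq0 -lt0n n_gt0 implybT.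
rewrite !ger0_norm ?mulr_ge0 ?sqrtr_ge0 //.
have [mixed _] := mix n n_gt0.
exact: (mixing_time_ge n_gt0 eps01 (ltn0Sn _) K_eps Kn n1 (stat n n_gt0) mixed).
Unshelve. all: by end_near. Qed.
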